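(* Let $z\ge y\ge2$, let $\mathcal{A}\subset\mathbb{N}$ be a primitive set, and let $f$ be a multiplicative function such that $0\le f(n)\le\tau_k(n)$ for all $n\in\mathbb{N}$, for some fixed integer $k\ge1$. If we let $L=\sum_{p\le y} \frac{f(p)}{p}$ (sum over primes), then we have the uniform estimate \[ \sum_{a\in\mathcal{A}\cap[z/y,z] } \frac{f(a)}{a} \ll_k \frac{\log y}{\sqrt{L+1}} \cdot \exp\bigg(\sum_{p\le z}\frac{f(p)-1}{p}\bigg), \] where the implied constant depends only on $k$.
   Context: A set $\mathcal{A}\subset\mathbb{N}$ is primitive if $a\nmid b$ for all distinct $a,b\in\mathcal{A}$. $\tau_k$ denotes the $k$-th divisor function, i.e. $\tau_k(n)$ is the number of ordered $k$-tuples of positive integers with product $n$. Sums over $p$ run over primes. *)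

(* Defs.v *)
From mathcomp Require Import all_boot all_order all_algebra.
From mathcomp Require Import all_classical all_reals all_analysis.
From mathcomp Require Export Rstruct.
Import Num.Theory.
Local Open Scope ring_scope.



(* tau_k n = number of ordered k-tuples of positive integers with product n
   (for n >= 1 every factor lies in [1, n], so tuples over 'I_n.+1 suffice). *)
Definition tau (k n : nat) : nat :=
  #|[set t : {ffun 'I_k -> 'I_n.+1} | [forall i, 0 < (t i : nat)]%N &&
        ((\prod_(i < k) (t i : nat))%N == n)]|.

Definition primitive (A : pred nat) : Prop :=
  (forall a, A a -> (0 < a)%N) /\
  (forall a b, A a -> A b -> a <> b -> ~~ (a %| b)%N).

Definition multiplicative (f : nat -> Rdefinitions.R) : Prop :=
  f 1%N = 1 /\
  (forall m n, (0 < m)%N -> (0 < n)%N -> coprime m n -> f (m * n)%N = f m * f n).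

(* Main.v *)
(** Factor [a = s * b], where [s] collects the primes [p] with [K < p <= y] that
    divide [a] exactly once ([K] depends on [k] only).  For fixed [b] the
    squarefree cofactors [s] of members of a primitive set form an antichain of
    sets of primes, and Sperner's theorem applied to a random set of primes
    bounds their weighted sum by [e^L / sqrt (L + 1)], even after inserting
    Rankin's factor [s^d] with [d = ln 2 / ln y].

    The missing factor [ln y / ln z] comes from
    [ln z <= ln y + ln s + ln b]: the first two terms are at most
    [3 ln y * s^d], and [ln b] is expanded as a sum over the prime powers exactly
    dividing [b], whose contribution is [O(ln y)] by Chebyshev's bound because
    [a >= z / y] allows the insertion of [2 (a / z)^d >= 1].  Finally
    [1 / ln z] is compared with [exp (- \sum_(p <= z) 1 / p)] by Mertens. *)

Require Import Defs.
From mathcomp Require Import all_boot all_order all_algebra.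
From mathcomp Require Import all_classical all_reals all_analysis.
From mathcomp Require Import zify ring lra.
Import Order.TTheory GRing.Theory Num.Theory.
Local Open Scope ring_scope.

(** Put P for the sum of f(p)/p over p <= z. Since [b] contains no prime of (K, y] to the exact
    first power, its Euler product is only O(e^(P - L)). Together with Sperner's e^L / sqrt (L + 1)
    for [s] this gives e^P / sqrt (L + 1), so the square root survives. Primes up to [K] stay in [b]
    because their weights could exceed 1 and could not be read as probabilities; they cost a
    constant depending on [k]. An additive term such as ln s would destroy the product form of the
    weight of [s], on which the random set of primes rests. Bounding it by s^d / d keeps that form.
    The choice of [d] balances two demands: 1/d = O(ln y), while p^d <= 2 for p <= y, so that the
    factor s^d changes L by O(2^k) only. *)

(** * Comparison of sums along injections *)

Lemma ler_sum_inj (R : numDomainType) (I J : eqType) (r : seq I) (s : seq J)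
    (P : pred I) (Q : pred J) (h : I -> J) (X : I -> R) (Y : J -> R) :
    uniq r -> uniq s ->
    (forall i, i \in r -> P i -> h i \in s /\ Q (h i)) ->
    {in [pred i | (i \in r) && P i] &, injective h} ->
    (forall i, i \in r -> P i -> X i <= Y (h i)) ->
    (forall j, j \in s -> Q j -> 0 <= Y j) ->
  \sum_(i <- r | P i) X i <= \sum_(j <- s | Q j) Y j.
Proof.
move=> ur us hs hinj XY Y0.
apply: (@le_trans _ _ (\sum_(i <- r | P i) Y (h i))).
  by rewrite big_seq_cond [leRHS]big_seq_cond; apply: ler_sum => i /andP[]; exact: XY.
rewrite -big_filter -(big_map h xpredT).
set t := map h _.
have ut : uniq t.
  rewrite map_inj_in_uniq ?filter_uniq // => i j.
  rewrite !mem_filter => /andP[Pi ri] /andP[Pj rj] hij.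
  by apply: hinj; rewrite ?inE ?ri ?rj.
have ts : {subset t <= [seq j <- s | Q j]}.
  move=> _ /mapP[i + ->]; rewrite mem_filter => /andP[Pi ri].
  by have [? ?] := hs _ ri Pi; rewrite mem_filter; apply/andP.
rewrite -[leRHS]big_filter [leRHS](bigID (mem t)) /= -[X in _ <= X + _]big_filter.
rewrite (perm_big [seq i <- [seq j <- s | Q j] | i \in t]); last first.
  apply: uniq_perm => //; first by rewrite !filter_uniq.
  move=> j; rewrite [RHS]mem_filter; apply/idP/idP; last by case/andP.
  by move=> tj; rewrite tj ts.
rewrite lerDl big_seq_cond; apply: sumr_ge0 => j /andP[+ _].
by rewrite mem_filter => /andP[? ?]; exact: Y0.
Qed.

(** * Central binomial coefficients and Sperner's theorem *)

(** By [mul_bin_left], (m+1) C(n,m+1) = (n-m) C(n,m), and n-m >= m+1 below the middle. The upper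
    half follows by symmetry. *)
Lemma bin_le_central n s : ('C(n, s) <= 'C(n, n./2))%N.
Proof.
have low t : (t <= n./2 -> 'C(n, n./2 - t) <= 'C(n, n./2))%N.
  elim: t => [|t IH] lt; first by rewrite subn0.
  apply: leq_trans (IH (ltnW lt)).
  set m := (n./2 - t.+1)%N.
  have -> : (n./2 - t = m.+1)%N by rewrite /m; lia.
  have e := mul_bin_left n m.
  have : (m.+1 * 'C(n, m) <= m.+1 * 'C(n, m.+1))%N.
    by rewrite e leq_mul2r; apply/orP; right; rewrite /m; lia.
  by rewrite leq_pmul2l.
have [sn|sn] := leqP s n; last by rewrite bin_small.
have [h|h] := leqP s n./2.
  by have := low (n./2 - s)%N (leq_subr _ _); rewrite subKn.
rewrite -bin_sub //.
have := low (n./2 - (n - s))%N (leq_subr _ _).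
by rewrite subKn //; lia.
Qed.

(** The factor [n.+1] is the source of the square root in the final estimate; squaring keeps the
    inequality in [nat]. In the even case the induction step reduces to (2m+1)(2m+3) <= 4(m+1)^2.
    The odd case follows from C(2m+2,m+1) = 2 C(2m+1,m). *)
Lemma central_bin_sqr n : ('C(n, n./2) ^ 2 * n.+1 <= 4 ^ n)%N.
Proof.
have even m : ('C(m.*2, m) ^ 2 * m.*2.+1 <= 16 ^ m)%N.
  elim: m => [|m IH]; first by [].
  have e : (m.+1 * 'C(m.+1.*2, m.+1) = 2 * m.*2.+1 * 'C(m.*2, m))%N.
    have e1 := mul_bin_diag m.*2.+2 m; have e2 := mul_bin_down m.*2.+1 m.
    apply/eqP; rewrite -(eqn_pmul2l (ltn0Sn m)) doubleS; apply/eqP.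
    have m1 : (m.*2.+1 - m = m.+1)%N by lia.
    move: e1 e2 => /=; rewrite m1 => <- e2.
    congr (_ * _)%N; rewrite -[RHS]mulnA e2 mulnA; congr (_ * _)%N; lia.
  have : (m.+1 ^ 2 * ('C(m.+1.*2, m.+1) ^ 2 * m.+1.*2.+1) <= m.+1 ^ 2 * 16 ^ m.+1)%N.
    rewrite mulnA -expnMn e !expnMn (expnS 16).
    have le4 : (m.*2.+1 * m.*2.+3 <= 4 * m.+1 ^ 2)%N by lia.
    have := leq_mul (leq_mul (leqnn 4) le4) IH; rewrite -!mulnn.
    by move: ('C(_, m) * 'C(_, m))%N (16 ^ m)%N => u v; lia.
  by rewrite leq_pmul2l // expn_gt0.
have [m] : exists m, n = m.*2 \/ n = m.*2.+1.
  by exists n./2; have := odd_double_half n; case: odd => /=; lia.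
case=> ->.
  by rewrite doubleK; apply: leq_trans (even m) _; rewrite -mul2n expnM.
have -> : (m.*2.+1)./2 = m by lia.
have := even m.+1.
have -> : 'C(m.+1.*2, m.+1) = (2 * 'C(m.*2.+1, m))%N.
  rewrite doubleS binS.
  have -> : 'C(m.*2.+1, m.+1) = 'C(m.*2.+1, m).
    rewrite -[RHS]bin_sub; last lia.
    by congr 'C(_, _); lia.
  by lia.
have -> : (4 ^ m.*2.+1 = 4 * 16 ^ m)%N by rewrite expnS -mul2n expnM.
rewrite expnMn (expnS 16) -!mulnn.
by move: ('C(_, m) * 'C(_, m))%N (16 ^ m)%N => u v; lia.
Qed.

Definition antichain (T : finType) (F : {set {set T}}) : Prop :=
  {in F &, forall S S' : {set T}, S \subset S' -> S = S'}.

Section Sperner.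
Variables (R : realType) (T : finType).
Implicit Types (F : {set {set T}}) (U S : {set T}).

(** Induction on [#|U|] in place of counting maximal chains. If [U] is in [F], it is the only member
    inside [U]. Otherwise the sum for [U] is the average over x in U of the sums for [U :\ x]: a set
    of size s survives the removal of n+1-s points, and (n+1-s) / ((n+1) C(n,s)) = 1 / C(n+1,s). *)
Lemma lubell_yamamoto_meshalkin F U : antichain T F ->
  \sum_(S in F | S \subset U) ('C(#|U|, #|S|))%:R^-1 <= 1 :> R.
Proof.
move=> aF; move En : #|U| => n; elim: n U En => [|n IH] U En.
  have U0 : U = finset.set0 by apply/eqP; rewrite -cards_eq0 En.
  apply: (@le_trans _ _ (\sum_(S in [set finset.set0 : {set T}]) (1 : R))); last first.
    by rewrite big_set1.
  rewrite [leRHS]big_mkcond [leLHS]big_mkcond; apply: ler_sum => S _.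
  rewrite U0 finset.subset0 inE; have [->|_] := eqVneq S finset.set0.
    by rewrite cards0 bin0 invr1 andbT; case: ifP.
  by rewrite andbF.
have [UF|UF] := boolP (U \in F).
  rewrite (big_pred1 U) => [|S]; first by rewrite En binn invr1.
  rewrite /=; apply/andP/eqP => [[SF SU]|->]; last by [].
  exact: aF.
pose X x := \sum_(S in F | S \subset U :\ x) (('C(n, #|S|))%:R^-1 : R).
have X1 x : x \in U -> X x <= 1.
  move=> xU; apply: IH; move: En; rewrite (cardsD1 x) xU; lia.
have -> : \sum_(S in F | S \subset U) ('C(n.+1, #|S|))%:R^-1 =
    n.+1%:R^-1 * \sum_(x in U) X x.
  rewrite /X (exchange_big_dep (fun S => (S \in F) && (S \subset U))) /=; last first.
    move=> x S xU /andP[SF] SU; rewrite SF /=.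
    exact: fintype.subset_trans SU (subD1set _ _).
  rewrite mulr_sumr; apply: eq_bigr => S /andP[SF SU].
  rewrite sumr_const -[_ *+ #|_|]mulr_natr.
  have ltS : (#|S| < n.+1)%N.
    rewrite -En proper_card // finset.properEneq SU andbT.
    by apply/eqP => SE; rewrite -SE SF in UF.
  have -> : #|(fun x : T => [&& x \in U, S \in F & S \subset U :\ x])| =
      (n.+1 - #|S|)%N.
    transitivity #|U :\: S|; last by rewrite cardsD (finset.setIidPr SU) En.
    apply: eq_card => x; rewrite finset.in_setD -[LHS]/[&& x \in U, S \in F & S \subset U :\ x].
    by rewrite SF subsetD1 SU andbC.
  have e := mul_bin_down n.+1 #|S|.
  have c1 : ('C(n.+1, #|S|))%:R != 0 :> R by rewrite pnatr_eq0 -lt0n bin_gt0 ltnW.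
  have c2 : ('C(n, #|S|))%:R != 0 :> R by rewrite pnatr_eq0 -lt0n bin_gt0.
  have c3 : n.+1%:R != 0 :> R by rewrite pnatr_eq0.
  have : n.+1%:R * ('C(n, #|S|))%:R = (n.+1 - #|S|)%:R * ('C(n.+1, #|S|))%:R :> R.
    by rewrite -!natrM e.
  move: c1 c2 c3; set u := _%:R => c1; set v := _%:R => c2; set w := _%:R => c3.
  set t := _%:R => E.
  have -> : t = w * v / u by rewrite E mulfK.
  by field; apply/and3P.
rewrite mulrC ler_pdivrMr ?ltr0n // mul1r.
apply: (le_trans (ler_sum _ X1)).
by rewrite sumr_const En.
Qed.

Lemma sperner_bound F U : antichain T F ->
  (#|[set S in F | S \subset U]|)%:R <= 2 ^+ #|U| / Num.sqrt (#|U|%:R + 1) :> R.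
Proof.
move=> aF; set n := #|U|.
have sq0 : 0 < Num.sqrt (n%:R + 1 : R).
  by rewrite sqrtr_gt0 ltr_wpDl.
have c0 s : ('C(n, s))%:R <= 2 ^+ n / Num.sqrt (n%:R + 1) :> R.
  rewrite ler_pdivlMr // -ler_sqr ?nnegrE ?mulr_ge0 ?sqrtr_ge0 ?exprn_ge0 //.
  rewrite exprMn sqr_sqrtr ?addr_ge0 // natr1.
  rewrite -exprM mulnC exprM -!natrX -natrM ler_nat.
  apply: leq_trans (central_bin_sqr n).
  by rewrite leq_mul2r leq_sqr bin_le_central orbT.
rewrite -sum1_card natr_sum.
have /(ler_wpM2l (ltW (divr_gt0 (exprn_gt0 n (ltr0n R 2)) sq0))) := lubell_yamamoto_meshalkin F U aF.
rewrite mulr1 mulr_sumr; apply: le_trans.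
under eq_bigl do rewrite inE.
apply: ler_sum => S /andP[SF SU].
have b0 : 0 < ('C(n, #|S|))%:R :> R by rewrite ltr0n bin_gt0 subset_leq_card.
by rewrite ler_pdivlMr // mul1r.
Qed.

(* If each [i] enters a random set [U] independently with probability [h i],
   then [\prod_(i in S) h i] is the probability that [S] is contained in [U]:
   the left-hand side is the expected number of members of [F] inside [U]. *)
Lemma weighted_sperner F (h : T -> R) (lam := \sum_i h i) :
    antichain T F -> (forall i, 0 <= h i <= 1) ->
  \sum_(S in F) \prod_(i in S) h i <= 3 * expR lam / Num.sqrt (lam + 1).
Proof.
move=> aF h01.
have h0 i : 0 <= h i by have /andP[] := h01 i.
have h1 i : 0 <= 1 - h i by have /andP[] := h01 i; lra.
have lam0 : 0 <= lam by apply: sumr_ge0.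
pose w U := \prod_i (if i \in U then h i else 1 - h i).
have w0 U : 0 <= w U by apply: prodr_ge0 => i _; case: ifP.
have wS S : \prod_(i in S) h i = \sum_(U : {set T} | S \subset U) w U.
  have -> : \prod_(i in S) h i = \prod_i (h i + (if i \in S then 0 else 1 - h i)).
    rewrite big_mkcond; apply: eq_bigr => i _; case: ifP => _; first by rewrite addr0.
    by rewrite addrC subrK.
  rewrite bigA_distr [RHS]big_mkcond; apply: eq_bigr => U _ /=.
  case: ifPn => [SU|/fintype.subsetPn[i iS iU]].
    apply: eq_bigr => i _; case: ifPn => // iU; case: ifPn => // iS.
    by rewrite (fintype.subsetP SU) in iU.
  by rewrite (bigD1 i) //= (negPf iU) iS mul0r.
under eq_bigr do rewrite wS.
rewrite (exchange_big_dep xpredT) //=.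
have sq0 : 0 < Num.sqrt (lam + 1) by rewrite sqrtr_gt0; lra.
(* Sperner's saving depends on the random size of [U]. If [#|U| >= lam / 2], it is at least sqrt
   (lam + 1) / 2; smaller sets have at most 2^(lam/2) <= e^(lam/2) subsets, and e^(lam/2) is later
   seen to be at most e^lam / sqrt (lam + 1). *)
have key U : (#|[set S in F | S \subset U]|)%:R <=
    2 ^+ #|U| * (2 / Num.sqrt (lam + 1)) + expR (lam / 2).
  apply: (le_trans (sperner_bound F U aF)).
  have p0 : 0 < 2 ^+ #|U| :> R by rewrite exprn_gt0.
  have [l|l] := leP (lam / 2) #|U|%:R.
    rewrite -[leLHS]addr0 lerD ?expR_ge0 // ler_pM2l //.
    rewrite ler_pdivlMr // mulrC ler_pdivrMr; last by rewrite sqrtr_gt0; lra.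
    rewrite -[2](@ger0_norm R) // -sqrtr_sqr -sqrtrM; last by rewrite sqr_ge0.
    by rewrite ler_sqrt; nra.
  rewrite -[leLHS]add0r; apply: lerD.
    by rewrite mulr_ge0 ?(ltW p0) // divr_ge0 // ltW.
  apply: (@le_trans _ _ (2 ^+ #|U|)).
    rewrite ler_pdivrMr; last by rewrite sqrtr_gt0 ltr_wpDl.
    apply: ler_peMr; first exact: ltW.
    by rewrite -[leLHS]sqrtr1; apply: ler_wsqrtr; rewrite lerDr.
  have e2 : 2 <= expR 1 :> R by have := expR_ge1Dx (1 : R); lra.
  apply: (@le_trans _ _ (expR 1 ^+ #|U|)).
    by rewrite lerXn2r ?nnegrE ?expR_ge0.
  by rewrite -expRM_natl ler_expR mulr1 ltW.
apply: (@le_trans _ _ (\sum_U w U * (2 ^+ #|U| * (2 / Num.sqrt (lam + 1)) + expR (lam / 2)))).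
  apply: ler_sum => U _.
  rewrite sumr_const -[leLHS]mulr_natr; apply: ler_wpM2l => //.
  apply: le_trans (key U); rewrite ler_nat.
  apply/subset_leq_card/fintype.subsetP => S.
  by rewrite !inE.
under eq_bigr do rewrite mulrDr (mulrA (w _)).
rewrite big_split /= -!mulr_suml.
have -> : \sum_U w U = 1.
  have := bigA_distr 1 +%R h (fun i => 1 - h i).
  rewrite /w => <-.
  by rewrite big1 // => i _ /=; ring.
(* By independence the expectation of [2 ^+ #|U|] factors. The product is also the total weight of
   all sets, so the antichain condition saves the square root against the trivial bound. *)
have -> : \sum_U w U * 2 ^+ #|U| = \prod_i (1 + h i).
  transitivity (\prod_i (h i * 2 + (1 - h i))); last by apply: eq_bigr => i _; ring.
  rewrite bigA_distr; apply: eq_bigr => U _ /=.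
  rewrite /w -prodr_const [X in _ * X]big_mkcond -big_split /=.
  by apply: eq_bigr => i _; case: ifP => // _; rewrite mulr1.
have prod_le : \prod_i (1 + h i) <= expR lam.
  rewrite expR_sum; apply: ler_prod => i _; rewrite expR_ge1Dx andbT.
  by have := h0 i; lra.
apply: (@le_trans _ _ (expR lam * (2 / Num.sqrt (lam + 1)) + expR lam / Num.sqrt (lam + 1))).
  apply: lerD; first by rewrite ler_wpM2r // divr_ge0 // ltW.
  rewrite mul1r ler_pdivlMr //.
  have -> : expR lam = expR (lam / 2) * expR (lam / 2).
    by rewrite -expRD; congr expR; lra.
  rewrite ler_pM2l ?expR_gt0 //.
  apply: (@le_trans _ _ (1 + lam / 2)); last exact: expR_ge1Dx.
  have e0 : 0 <= 1 + lam / 2 by lra.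
  rewrite -[leRHS]ger0_norm // -sqrtr_sqr ler_sqrt; nra.
rewrite -!mulrA [_ * (2 * _)]mulrCA -[X in _ + X]mul1r -mulrDl.
by rewrite [2 + 1]natr1.
Qed.

End Sperner.

(** * Double sums, and Chebyshev's bounds for primes *)

(** Serves to replace a sum over integers by a double sum over the two parts of a factorisation;
    pairs that do not occur only add nonnegative terms. *)
Lemma ler_sum_inj2 (R : numDomainType) (I J1 J2 : eqType) (r : seq I)
    (s1 : seq J1) (s2 : seq J2) (P : pred I) (Q : J1 -> pred J2)
    (h1 : I -> J1) (h2 : I -> J2) (X : I -> R) (Y : J1 -> J2 -> R) :
    uniq r -> uniq s1 -> uniq s2 ->
    (forall i, i \in r -> P i -> [/\ h1 i \in s1, h2 i \in s2 & Q (h1 i) (h2 i)]) ->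
    {in [pred i | (i \in r) && P i] &, forall i i', h1 i = h1 i' -> h2 i = h2 i' -> i = i'} ->
    (forall i, i \in r -> P i -> X i <= Y (h1 i) (h2 i)) ->
    (forall j l, j \in s1 -> l \in s2 -> Q j l -> 0 <= Y j l) ->
  \sum_(i <- r | P i) X i <= \sum_(j <- s1) \sum_(l <- s2 | Q j l) Y j l.
Proof.
move=> ur us1 us2 hs hinj XY Y0.
have -> : \sum_(j <- s1) \sum_(l <- s2 | Q j l) Y j l =
    \sum_(x <- [seq (j, l) | j <- s1, l <- s2] | Q x.1 x.2) Y x.1 x.2.
  rewrite [RHS]big_mkcond big_allpairs; apply: eq_bigr => j _.
  exact: big_mkcond.
apply: (@ler_sum_inj _ _ _ _ _ _ _ (fun i => (h1 i, h2 i))) => //.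
- by apply: allpairs_uniq => // -[? ?] [? ?].
- move=> i ri Pi; have [? ? ?] := hs i ri Pi; split => //.
  by apply/allpairsP; exists (h1 i, h2 i); split.
- by move=> i i' Pi Pi' [] /(hinj _ _ Pi Pi').
- move=> x /allpairsP[[j l] /= [sj sl ->]] /=; exact: Y0.
Qed.

Lemma prime_dvd_central_bin n p : prime p -> (n < p <= n.*2)%N -> (p %| 'C(n.*2, n))%N.
Proof.
move=> pp /andP[np pn].
have nf m : (m < p)%N -> ~~ (p %| m`!)%N.
  elim: m => [|m IH] mp; first by rewrite fact0 dvdn1; case: p pp {np pn mp} => [|[]].
  by rewrite factS Euclid_dvdM // negb_or IH ?(ltnW mp) // andbT gtnNdvd.
have : (p %| n.*2`!)%N by rewrite dvdn_fact // prime_gt0.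
rewrite -(@bin_fact n.*2 n) ?Euclid_dvdM //; last by rewrite -addnn leq_addr.
have -> : (n.*2 - n = n)%N by lia.
by rewrite (negPf (nf n np)) !orbF.
Qed.

Lemma coprime_prod_primes p (s : seq nat) :
  prime p -> all prime s -> p \notin s -> coprime p (\prod_(q <- s) q).
Proof.
move=> pp prs ps.
rewrite big_seq; apply: (big_ind (fun n => coprime p n)) => [|a b pa pb|q qs].
- exact: coprimen1.
- by rewrite coprimeMr pa.
- rewrite prime_coprime // dvdn_prime2 ?(allP prs q qs) //.
  by apply: contraNN ps => /eqP ->.
Qed.

Lemma prod_primes_dvd (s : seq nat) m :
  uniq s -> all prime s -> {in s, forall p, (p %| m)%N} -> (\prod_(p <- s) p %| m)%N.
Proof.
elim: s => [|p s IH] /=; first by rewrite big_nil dvd1n.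
move=> /andP[ps us] /andP[pp prs] sm.
rewrite big_cons Gauss_dvd ?coprime_prod_primes //.
by rewrite sm ?mem_head // IH // => q qs; apply: sm; rewrite inE qs orbT.
Qed.

Section Primes.
Variable R : realType.
Implicit Types (d x : R).

Lemma ln2_ge_half : 2^-1 <= ln 2 :> R.
Proof.
have := @le_ln1Dx R (- 2^-1) ltac:(lra).
have -> : 1 + - 2^-1 = 2^-1 :> R by lra.
rewrite lnV ?posrE //; lra.
Qed.

Lemma ln2_le1 : ln 2 <= 1 :> R.
Proof. by have := @le_ln1Dx R 1 ltac:(lra). Qed.

Lemma ln_prod (I : Type) (r : seq I) (P : pred I) (g : I -> R) :
  (forall i, P i -> 0 < g i) ->
  ln (\prod_(i <- r | P i) g i) = \sum_(i <- r | P i) ln (g i).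
Proof.
move=> g0; apply: (@expR_inj R); rewrite expR_sum lnK ?posrE ?prodr_gt0 //.
by apply: eq_bigr => i Pi; rewrite lnK // posrE g0.
Qed.

(** Chebyshev's argument: the primes in (n, 2n] all divide C(2n,n), which is at most 4^n. *)
Lemma sum_ln_primes_dyadic n :
  \sum_(n.+1 <= p < n.*2.+1 | prime p) ln p%:R <= n%:R * ln 4 :> R.
Proof.
set c := 'C(n.*2, n).
have c0 : (0 < c)%N by rewrite bin_gt0 -addnn leq_addr.
rewrite -ln_prod => [|p pp]; last by rewrite ltr0n prime_gt0.
rewrite -natr_prod mulr_natl -lnXn // -natrX.
have : (\prod_(n.+1 <= p < n.*2.+1 | prime p) p %| c)%N.
  rewrite -big_filter; apply: prod_primes_dvd.
  - by rewrite filter_uniq // iota_uniq.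
  - exact: filter_all.
  - move=> p; rewrite mem_filter mem_index_iota => /andP[pp np].
    by apply: prime_dvd_central_bin => //; rewrite -ltnS.
move=> /(dvdn_leq c0) le_c.
have P0 : (0 < \prod_(n.+1 <= p < n.*2.+1 | prime p) p)%N.
  by rewrite prodn_cond_gt0 // => p /prime_gt0.
rewrite ler_ln ?posrE ?ltr0n ?expn_gt0 // ler_nat.
apply: leq_trans le_c _.
have := central_bin_sqr n.*2; rewrite doubleK -/c -muln2 expnM.
move=> H; rewrite -(@leq_exp2r _ _ 2) //; apply: leq_trans H.
by rewrite leq_pmulr.
Qed.

Lemma powR_ge1_nat n d : (0 < n)%N -> 0 <= d -> 1 <= n%:R `^ d.
Proof.
by move=> n0 d0; rewrite -[leLHS](powRr0 n%:R); apply: ler_powR; rewrite ?ler1n.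
Qed.

Lemma powR_expR x d : 0 < x -> x `^ d = expR (d * ln x).
Proof. by move=> x0; rewrite /powR gt_eqF. Qed.

Lemma sum_ln_primes_pow2 J d : 0 < d <= 1 ->
  \sum_(0 <= p < (2 ^ J).+1 | prime p) ln p%:R / p%:R * p%:R `^ d
    <= 4 * (2 ^ J)%:R `^ d / d.
Proof.
move=> /andP[d0 d1]; elim: J => [|J IH].
  rewrite big1_seq => [|p /andP[pp]].
    by rewrite divr_ge0 ?mulr_ge0 ?powR_ge0 // ltW.
  by rewrite mem_index_iota; case: p pp => [|[]].
rewrite (@big_cat_nat _ _ _ (2 ^ J).+1) //=; last by rewrite ltnS leq_exp2l.
set x := (2 ^ J)%:R `^ d in IH *.
have x0 : 0 < x by rewrite powR_gt0 // ltr0n expn_gt0.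
have -> : (2 ^ J.+1)%:R `^ d = 2 `^ d * x.
  by rewrite expnS natrM powRM.
have t1 : 1 + d * ln 2 <= 2 `^ d by rewrite powR_expR // expR_ge1Dx.
set t := 2 `^ d in t1 *.
have q0 : 0 < (2 ^ J)%:R :> R by rewrite ltr0n expn_gt0.
have step : \sum_((2 ^ J).+1 <= p < (2 ^ J.+1).+1 | prime p)
    ln p%:R / p%:R * p%:R `^ d <= ln 4 * (t * x).
  apply: (@le_trans _ _ (\sum_((2 ^ J).+1 <= p < (2 ^ J.+1).+1 | prime p)
      ln p%:R * ((2 ^ J)%:R^-1 * (t * x)))).
    rewrite big_nat_cond [leRHS]big_nat_cond; apply: ler_sum => p.
    move=> /andP[/andP[p1 p2] pp]; rewrite -mulrA.
    have p0 : 0 < p%:R :> R by rewrite ltr0n prime_gt0.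
    apply: ler_wpM2l; first by rewrite ln_ge0 // ler1n prime_gt0.
    apply: ler_pM; rewrite ?invr_ge0 ?powR_ge0 ?(ltW p0) //.
      by rewrite lef_pV2 ?posrE // ler_nat ltnW.
    rewrite /t /x -powRM // -natrM -expnS.
    apply: ge0_ler_powR; rewrite ?nnegrE ?ler0n ?(ltW d0) //.
    by rewrite ler_nat -ltnS.
  rewrite -mulr_suml [leLHS]mulrA ler_wpM2r ?mulr_ge0 ?powR_ge0 ?(ltW x0) //.
  rewrite ler_pdivrMr // mulrC expnS mul2n; exact: sum_ln_primes_dyadic.
apply: (le_trans (lerD IH step)).
have -> : ln 4 = 2 * ln 2 :> R.
  have -> : 4 = 2 ^+ 2 :> R by rewrite -natrX.
  by rewrite lnXn // mulr_natl.
have u1 := ln2_le1; have u0 := ln2_ge_half.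
rewrite -(ler_pM2r d0) mulrDl !divfK ?gt_eqF //.
set l := ln 2 in t1 u1 u0 *.
have dl : d * l <= 1 by nra.
have dl0 : 0 <= d * l by nra.
(* This closes the induction: each dyadic block adds at most 2 l t x, and t = 2^d >= 1 + dl with dl
   <= 1 gives t(4 - 2dl) >= 4 + 2dl(1 - dl) >= 4. *)
have H : 0 <= t * (4 - 2 * (d * l)) - 4 by nra.
have -> : 4 * x + 2 * l * (t * x) * d = 4 * (t * x) - (t * (4 - 2 * (d * l)) - 4) * x by ring.
by rewrite lerBlDr lerDl mulr_ge0 // ltW.
Qed.

(** The weight damps the primes far below [x], so the bound is free of [x]; this is why ln b will
    cost O(1/d) = O(ln y) and not O(ln z). Rounding up to a power of two, at most 2x, loses 2^d <= 2
    and turns 4 into 8. *)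
Lemma sum_ln_primes_weighted d x : 0 < d <= 1 -> 1 <= x ->
  \sum_(0 <= p < (Num.truncn x).+1 | prime p) ln p%:R / p%:R * (p%:R / x) `^ d
    <= 8 / d.
Proof.
move=> d01 x1; have /andP[d0 d1] := d01.
have x0 : 0 < x by lra.
have xd0 : 0 < x `^ d by rewrite powR_gt0.
set n := Num.truncn x.
have n0 : (0 < n)%N by rewrite /n truncn_ge_nat // ltW.
have [J1 J2] := andP (trunc_log_bounds (ltnSn 1) n0).
set J := trunc_log 2 n in J1 J2.
apply: (@le_trans _ _ ((\sum_(0 <= p < (2 ^ J.+1).+1 | prime p)
    ln p%:R / p%:R * p%:R `^ d) / x `^ d)).
  rewrite mulr_suml (@big_cat_nat _ _ _ n.+1 0 (2 ^ J.+1).+1) //=; last by rewrite ltnS ltnW.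
  rewrite -[leLHS]addr0; apply: lerD.
    apply: ler_sum => p pp; rewrite -[leRHS]mulrA; apply: ler_wpM2l.
      by rewrite divr_ge0 // ln_ge0 // ler1n prime_gt0.
    by rewrite powRM ?invr_ge0 ?(ltW x0) // -powRN -(powR_inv1 (ltW x0)) -powRrM mulN1r.
  apply: sumr_ge0 => p pp; rewrite divr_ge0 ?(ltW xd0) // mulr_ge0 ?powR_ge0 //.
  by rewrite divr_ge0 // ln_ge0 // ler1n prime_gt0.
rewrite ler_pdivrMr //; apply: (le_trans (sum_ln_primes_pow2 J.+1 d d01)).
rewrite [leRHS]mulrAC; apply: ler_wpM2r; first by rewrite invr_ge0 ltW.
rewrite -[8]/(4 * 2)%:R natrM -mulrA ler_pM2l //.
rewrite expnS natrM powRM //; apply: ler_pM; rewrite ?powR_ge0 //.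
  by rewrite -[leRHS]powRr1 //; apply: ler_powR => //; lra.
apply: ge0_ler_powR; rewrite ?nnegrE ?(ltW d0) ?(ltW x0) //.
by rewrite -truncn_ge_nat // ltW.
Qed.

(** With [d] chosen so that x^d = 2, every weight (p/x)^d is at least 1/2; then 16/d = 16 ln x / ln
    2 <= 32 ln x. *)
Lemma sum_ln_primes_le x : 2 <= x ->
  \sum_(0 <= p < (Num.truncn x).+1 | prime p) ln p%:R / p%:R <= 32 * ln x.
Proof.
move=> x2; have l2 := ln2_ge_half; have x0 : 0 < x by lra.
have lx : ln 2 <= ln x by rewrite ler_ln ?posrE.
have lx0 : 0 < ln x by lra.
pose d := ln 2 / ln x.
have d0 : 0 < d by rewrite divr_gt0 //; lra.
have d1 : d <= 1 by rewrite ler_pdivrMr // mul1r.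
have xd : x `^ d = 2 by rewrite powR_expR // /d divfK ?gt_eqF // lnK ?posrE.
have := @sum_ln_primes_weighted d x; rewrite d0 d1 => /(_ isT ltac:(lra)).
move=> H; apply: (@le_trans _ _ (2 * (8 / d))).
  apply: le_trans (ler_wpM2l _ H) => //.
  rewrite mulr_sumr; apply: ler_sum => p pp; rewrite mulrCA ler_peMr //.
    by rewrite divr_ge0 // ln_ge0 // ler1n prime_gt0.
  rewrite powRM ?invr_ge0 ?(ltW x0) // -(powR_inv1 (ltW x0)) powRAC xd.
  rewrite powR_inv1 // mulrCA mulfV ?pnatr_eq0 // mulr1.
  by apply: powR_ge1_nat; rewrite ?prime_gt0 // ltW.
rewrite /d invf_div !mulrA ler_pdivrMr; last by lra.
nra.
Qed.

Lemma sum_powR_le N d : 0 < d ->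
  \sum_(1 <= n < N.+1) n%:R `^ (- (1 + d)) <= 1 + d^-1 :> R.
Proof.
move=> d0; case: N => [|N]; first by rewrite big_geq // addr_ge0 // invr_ge0 ltW.
(* The subtracted term makes the bound telescope, as the integral of t^(-1-d) would; the step rests
   on ln(1 - 1/m) <= -1/m. *)
suff: \sum_(1 <= n < N.+2) n%:R `^ (- (1 + d)) <= 1 + d^-1 - N.+1%:R `^ (- d) / d :> R.
  move=> /le_trans; apply; rewrite gerBl divr_ge0 ?powR_ge0 //; exact: ltW.
elim: N => [|N IH]; first by rewrite big_nat1 !powR1 mul1r addrK.
rewrite big_nat_recr //=; apply: le_trans (lerD IH (lexx _)) _.
set m := N.+2%:R : R; set u := N.+1%:R : R.
have u0 : 0 < u by rewrite ltr0n.
have m0 : 0 < m by rewrite ltr0n.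
have mu : m = u + 1 by rewrite /m -natr1.
have i1 : m^-1 < 1 by rewrite invf_lt1 // ltr1n.
clearbody m u.
have lum : ln u <= ln m - m^-1.
  have -> : u = m * (1 + - m^-1) by rewrite mulrDr mulr1 mulrN divff ?gt_eqF // mu addrK.
  rewrite lnM ?posrE ?subr_gt0 // lerD2l; apply: le_ln1Dx.
  by rewrite ltrN2.
have key : m `^ (- d) * (1 + d / m) <= u `^ (- d).
  rewrite !powR_expR //.
  apply: (@le_trans _ _ (expR (- d * ln m) * expR (d / m))).
    by rewrite ler_pM2l ?expR_gt0 // expR_ge1Dx.
  rewrite -expRD ler_expR; nra.
have -> : m `^ (- (1 + d)) = m `^ (- d) / m.
  rewrite -(powR_inv1 (ltW m0)) -powRD; last by rewrite (gt_eqF m0) implybT.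
  by congr (_ `^ _); lra.
set A := m `^ _ in key *; set B := u `^ _ in key *.
have : A / m <= (B - A) / d.
  by rewrite ler_pdivlMr //; move: (m^-1) key => i; lra.
rewrite mulrBl; move: (A / m) (B / d) (A / d) (d^-1) => ? ? ? ?; lra.
Qed.

End Primes.

(** * Smooth numbers, Euler products and Mertens' upper bound *)

Definition smooth_lt (j n : nat) := all (fun p => p < j)%N (primes n).

Lemma smooth_ltS j n : smooth_lt j n -> smooth_lt j.+1 n.
Proof. by apply: sub_all => p; apply: leqW. Qed.

Lemma smooth_ltM j m n : (0 < m)%N -> (0 < n)%N ->
  smooth_lt j m -> smooth_lt j n -> smooth_lt j (m * n).
Proof.
move=> m0 n0 /allP sm /allP sn; apply/allP => p; rewrite primesM //.
by case/orP => [/sm|/sn].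
Qed.

Lemma smooth_lt_ndvd p n : prime p -> (0 < n)%N -> smooth_lt p n -> ~~ (p %| n)%N.
Proof.
move=> pp n0 /allP sn; apply/negP => pn.
by have := sn p; rewrite mem_primes pp n0 pn ltnn => /(_ isT).
Qed.

Lemma smooth_lt_nprime p n : ~~ prime p -> smooth_lt p.+1 n = smooth_lt p n.
Proof.
move=> pp; apply/idP/idP; last exact: smooth_ltS.
move=> /allP sn; apply/allP => q qn; have := sn q qn.
rewrite ltnS leq_eqVlt => /orP[/eqP qp|//].
by move: qn; rewrite mem_primes qp (negPf pp).
Qed.

Section EulerProducts.
Variable R : realType.
Implicit Types (x d : R).

(** Multiplying out yields distinct integers. A new prime [N] contributes the multiples [N * n] of
    the earlier ones, so the range grows from [M] to [N * M]. *)
Lemma prod_primes_le_sum (g : nat -> R) N :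
    (forall n, 0 <= g n) -> g 1%N = 1 ->
    (forall m n, (0 < m)%N -> (0 < n)%N -> g (m * n)%N = g m * g n) ->
  exists M, \prod_(0 <= p < N | prime p) (1 + g p) <=
            \sum_(1 <= n < M.+1 | smooth_lt N n) g n.
Proof.
move=> g0 g1 gM; elim: N => [|N [M IH]].
  by exists 1%N; rewrite big_geq // big_mkcond big_nat1 g1.
rewrite big_mkcond big_nat_recr //= -big_mkcond /=; case: ifP => pN; last first.
  exists M; rewrite mulr1; apply: (le_trans IH); rewrite le_eqVlt; apply/orP; left.
  by apply/eqP/eq_bigl => n; rewrite smooth_lt_nprime ?pN.
have N0 := prime_gt0 pN.
exists (N * M)%N; rewrite mulrDr mulr1.
rewrite [leRHS](bigID (fun n => ~~ (N %| n)%N)) /=; apply: lerD.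
  apply: (le_trans IH).
  apply: (@ler_sum_inj _ _ _ _ _ _ _ id) => //; rewrite ?iota_uniq // => n.
  rewrite !mem_index_iota => /andP[n1 nM] sn; split.
    by rewrite n1 ltnS (leq_trans (_ : n <= M)%N) // leq_pmull.
  by rewrite smooth_ltS // smooth_lt_ndvd.
apply: (le_trans (ler_wpM2r (g0 N) IH)); rewrite mulr_suml.
apply: (@ler_sum_inj _ _ _ _ _ _ _ (muln N)); rewrite ?iota_uniq //.
- move=> n; rewrite !mem_index_iota => /andP[n1 nM] sn; split.
    by rewrite muln_gt0 N0 n1 ltnS leq_pmul2l.
  rewrite dvdn_mulr ?andbT // smooth_ltM //; last exact: smooth_ltS.
  by rewrite /smooth_lt primes_prime //= ltnSn.
- by move=> m n _ _ /eqP; rewrite eqn_pmul2l // => /eqP.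
- by move=> n; rewrite mem_index_iota => /andP[n1 _] _; rewrite gM // mulrC.
Qed.

Lemma sum_primes_le_sum (g : nat -> R) N : (forall n, 0 <= g n) ->
  \sum_(0 <= p < N.+1 | prime p) g p <= \sum_(1 <= n < N.+1) g n.
Proof.
move=> g0; rewrite big_mkcond big_ltn //= add0r.
by apply: ler_sum => n _; case: ifP.
Qed.

(** Bound e^(-s) below by 1 - s at s = t - t^2 and use (1 + t)(1 - t + t^2) = 1 + t^3 >= 1. The loss
    t^2 is harmless for t close to 1/p, since the squares are summable. *)
Lemma expR_le_1Dx t : 0 <= t <= 1 -> expR (t - t ^+ 2) <= 1 + t :> R.
Proof.
move=> /andP[t0 t1].
have h := expR_ge1Dx (- (t - t ^+ 2)).
have q0 : 0 < 1 - (t - t ^+ 2) by nra.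
rewrite -[t - _]opprK expRN.
apply: (@le_trans _ _ (1 - (t - t ^+ 2))^-1).
  by rewrite lef_pV2 ?posrE // (lt_le_trans q0).
rewrite -[leLHS]mul1r ler_pdivrMr //.
have : 0 <= t ^+ 3 by rewrite exprn_ge0.
move=> t3; rewrite (_ : _ * _ = 1 + t ^+ 3); last by ring.
by rewrite lerDl.
Qed.

(* With [d = 1 / ln x] the factor [p `^ - d] costs only [exp (O(1))] over the
   primes up to [x], and the Euler product of [n `^ - (1 + d)] is at most
   [1 + 1 / d]. *)
Lemma mertens_upper : exists2 C : R, 0 < C & forall x, 2 <= x ->
  expR (\sum_(0 <= p < (Num.truncn x).+1 | prime p) p%:R^-1) <= C * ln x.
Proof.
(* Here 3 comes from 1 + ln x <= 3 ln x, and 34 = 2 + 32: the sum of [g p ^+ 2] is at most 2, and 32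
   is the constant of [sum_ln_primes_le]. *)
exists (expR 34 * 3); first by rewrite mulr_gt0 ?expR_gt0.
move=> x x2; have l2 := ln2_ge_half R; have x0 : 0 < x by lra.
have lx : ln 2 <= ln x by rewrite ler_ln ?posrE.
have lx0 : 0 < ln x by lra.
pose d := (ln x)^-1; have d0 : 0 < d by rewrite invr_gt0.
pose g n := n%:R `^ (- (1 + d)) : R.
set N := Num.truncn x.
have gM m n : (0 < m)%N -> (0 < n)%N -> g (m * n)%N = g m * g n.
  by move=> _ _; rewrite /g natrM powRM.
have gone : g 1%N = 1 by rewrite /g powR1.
have [M HM] := prod_primes_le_sum g N.+1 (fun n => powR_ge0 _ _) gone gM.
have prod_le : \prod_(0 <= p < N.+1 | prime p) (1 + g p) <= 3 * ln x.
  apply: (le_trans HM); apply: (@le_trans _ _ (\sum_(1 <= n < M.+1) g n)).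
    rewrite big_mkcond; apply: ler_sum => n _; case: ifP => // _.
    exact: powR_ge0.
  apply: (le_trans (sum_powR_le _ M _ d0)); rewrite invrK; lra.
have g1 p : prime p -> 0 <= g p <= 1.
  move=> pp; rewrite powR_ge0 /g powRN invf_le1 ?powR_gt0 ?ltr0n ?prime_gt0 //.
  by rewrite powR_ge1_nat ?prime_gt0 // addr_ge0 // ltW.
have sq p : prime p -> (g p) ^+ 2 <= p%:R `^ (- (1 + 1)).
  move=> pp; rewrite -powR_mulrn ?powR_ge0 // -powRrM; apply: ler_powR.
    by rewrite ler1n prime_gt0.
  lra.
have invp p : prime p -> p%:R^-1 <= g p + d * (ln p%:R / p%:R).
  move=> pp; have p0 : 0 < p%:R :> R by rewrite ltr0n prime_gt0.
  have -> : g p = p%:R^-1 * expR (- d * ln p%:R).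
    rewrite /g opprD powRD ?powR_inv1 ?ltW //; last by rewrite (gt_eqF p0) implybT.
    by rewrite powR_expR.
  have i0 : 0 <= p%:R^-1 :> R by rewrite invr_ge0 ltW.
  move: (ln p%:R) (p%:R^-1) i0 => l i i0.
  have := ler_wpM2l i0 (expR_ge1Dx (- d * l)); lra.
have -> : expR 34 = expR 2 * expR 32 :> R by rewrite -expRD; congr expR; ring.
apply: (@le_trans _ _ ((\prod_(0 <= p < N.+1 | prime p) (1 + g p)) *
   expR (\sum_(0 <= p < N.+1 | prime p) (g p) ^+ 2) *
   expR (d * \sum_(0 <= p < N.+1 | prime p) ln p%:R / p%:R))).
  apply: (@le_trans _ _ (expR (\sum_(0 <= p < N.+1 | prime p) (g p - g p ^+ 2) +
      \sum_(0 <= p < N.+1 | prime p) (g p) ^+ 2 +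
      d * \sum_(0 <= p < N.+1 | prime p) ln p%:R / p%:R))).
    rewrite ler_expR mulr_sumr -!big_split /=; apply: ler_sum => p pp.
    by rewrite subrK invp.
  rewrite !expRD -!mulrA; apply: ler_wpM2r; first by rewrite mulr_ge0 ?expR_ge0.
  rewrite expR_sum; apply: ler_prod => p pp.
  by rewrite expR_ge0 expR_le_1Dx ?g1.
rewrite -mulrA mulrC -[leRHS]mulrA; apply: ler_pM => //.
  by apply: prodr_ge0 => p pp; have /andP[] := g1 p pp; lra.
apply: ler_pM; rewrite ?expR_ge0 // ler_expR.
  apply: (@le_trans _ _ (\sum_(1 <= n < N.+1) n%:R `^ (- (1 + 1)))).
    apply: le_trans (sum_primes_le_sum (fun n => n%:R `^ (- (1 + 1))) N _) => [|n].
      exact: ler_sum.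
    exact: powR_ge0.
  by apply: (le_trans (sum_powR_le _ N _ ltr01)); rewrite invr1.
by rewrite /d mulrC ler_pdivrMr // sum_ln_primes_le.
Qed.

(** Peel off one prime at a time: an integer with all primes at most [j] is [j ^ v] times one with
    all primes below [j], and v <= N because [logn j n < n]. *)
Lemma sum_le_euler_product (F : nat -> R) N :
    (forall n, 0 <= F n) -> F 1%N <= 1 ->
    (forall m n, (0 < m)%N -> (0 < n)%N -> coprime m n -> F (m * n)%N <= F m * F n) ->
  \sum_(1 <= n < N.+1) F n <=
  \prod_(0 <= p < N.+1 | prime p) \sum_(0 <= v < N.+1) F (p ^ v)%N.
Proof.
move=> F0 F1 FM.
suff main j : \sum_(1 <= n < N.+1 | smooth_lt j n) F n <=
    \prod_(0 <= p < j | prime p) \sum_(0 <= v < N.+1) F (p ^ v)%N.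
  apply: le_trans (main N.+1); rewrite big_nat [leRHS]big_nat_cond le_eqVlt.
  apply/orP; left; apply/eqP/eq_bigl => n; case: andP => // -[n1 nN] /=.
  symmetry; apply/allP => p; rewrite mem_primes => /and3P[_ _ /dvdn_leq].
  by move=> /(_ n1) /leq_ltn_trans; apply.
elim: j => [|j IH].
  rewrite big_geq //; apply: le_trans F1.
  have [N0|N0] := posnP N; first by rewrite N0 big_geq.
  rewrite big_mkcond big_ltn ?ltnS //= big_nat_cond big1 ?addr0 // => n.
  rewrite andbT => /andP[n1 _]; case: ifP => // /allP sn.
  by have := sn (pdiv n); rewrite mem_primes pdiv_prime // pdiv_dvd ltnW // => /(_ isT).
rewrite [leRHS]big_mkcond big_nat_recr //= -big_mkcond /=.
case: ifP => pj; last first.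
  rewrite mulr1; apply: le_trans IH; rewrite le_eqVlt; apply/orP; left.
  by apply/eqP/eq_bigl => n; rewrite smooth_lt_nprime ?pj.
apply: (@le_trans _ _ (\sum_(0 <= v < N.+1) \sum_(1 <= m < N.+1 | smooth_lt j m)
    F (j ^ v)%N * F m)); last first.
  have -> : \sum_(0 <= v < N.+1) \sum_(1 <= m < N.+1 | smooth_lt j m) F (j ^ v)%N * F m =
      (\sum_(0 <= v < N.+1) F (j ^ v)%N) * \sum_(1 <= m < N.+1 | smooth_lt j m) F m.
    by rewrite mulr_suml; apply: eq_bigr => v _; rewrite mulr_sumr.
  by rewrite mulrC ler_wpM2r // sumr_ge0.
apply: (@ler_sum_inj2 _ _ _ _ _ _ _ _ (fun _ m => smooth_lt j m)
   (logn j) (fun n => n`_j^')%N); rewrite ?iota_uniq //.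
- move=> n; rewrite !mem_index_iota => /andP[n1 nN] sn.
  rewrite (leq_trans (ltn_logl j n1)) ?(ltnW nN) // part_gt0 /=.
  split=> //; first by rewrite (leq_ltn_trans _ nN) // dvdn_leq // dvdn_part.
  apply/allP => p; rewrite primes_part mem_filter => /andP[pj' pn].
  have /allP/(_ p pn) := sn.
  by rewrite ltnS leq_eqVlt => /orP[/eqP pE|//]; rewrite pE !inE eqxx in pj'.
- move=> m n; rewrite !inE !mem_index_iota => /andP[/andP[m1 _] _] /andP[/andP[n1 _] _].
  move=> e1 e2; rewrite -(partnC j m1) -(partnC j n1) !p_part e1.
  by congr muln.
- move=> n; rewrite mem_index_iota => /andP[n1 _] _.
  rewrite -{1}(partnC j n1) p_part; apply: FM; rewrite ?part_gt0 //.
  by rewrite -p_part coprime_partC.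
- by move=> v m _ _ _; rewrite mulr_ge0.
Qed.

Lemma ln_sum_logn N n : (0 < n <= N)%N ->
  ln n%:R = \sum_(0 <= p < N.+1 | prime p) (logn p n)%:R * ln p%:R :> R.
Proof.
move=> /andP[n0 nN]; rewrite -{1}(partnT n0) (widen_partn _ nN).
rewrite (bigID prime) /= [X in (_ * X)%N]big1 ?muln1; last first.
  by move=> p pp; rewrite lognE (negPf pp) expn0.
rewrite natr_prod ln_prod => [|p pp]; last by rewrite ltr0n expn_gt0 prime_gt0.
by apply: eq_bigr => p pp; rewrite natrX lnXn ?ltr0n ?prime_gt0 // mulr_natl.
Qed.

(* The Chebyshev-style identity [ln b = \sum_p logn p b * ln p] reduces the
   logarithmically weighted sum to sums over prime powers. *)
Lemma sum_ln_weighted (F : nat -> R) x d G :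
    let N := Num.truncn x in
    1 <= x -> 0 <= d ->
    (forall n, 0 <= F n) ->
    (forall m n, (0 < m)%N -> (0 < n)%N -> coprime m n -> F (m * n)%N <= F m * F n) ->
    (forall Z, 1 <= Z <= x -> \sum_(0 <= p < N.+1 | prime p)
       \sum_(1 <= v < N.+1 | (p ^ v)%:R <= Z)
         F (p ^ v)%N * (v%:R * ln p%:R) * ((p ^ v)%:R / Z) `^ d <= G) ->
  \sum_(1 <= b < N.+1) F b * (b%:R / x) `^ d * ln b%:R <=
  G * \sum_(1 <= b < N.+1) F b.
Proof.
move=> N x1 d0 F0 FM HG; have x0 : 0 < x by lra.
have xN n : (n <= N)%N = (n%:R <= x) by rewrite truncn_ge_nat // ltW.
(* For b = p^v m the weight (b/x)^d equals (p^v / (x/m))^d. With [m] fixed, what remains is the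
   prime power sum of the hypothesis at Z = x/m, bounded by [G] uniformly in [m]. *)
pose T p v m : R := F m * (F (p ^ v)%N * (v%:R * ln p%:R) * ((p ^ v)%:R / (x / m%:R)) `^ d).
apply: (@le_trans _ _ (\sum_(0 <= p < N.+1 | prime p)
   \sum_(1 <= v < N.+1) \sum_(1 <= m < N.+1 | (p ^ v)%:R <= x / m%:R) T p v m)).
  rewrite big_nat.
  under eq_bigr => b bN do rewrite (@ln_sum_logn N) // mulr_sumr.
  rewrite -big_nat exchange_big /=; apply: ler_sum => p pp.
  have p0 := prime_gt0 pp.
  rewrite (bigID (fun b => p %| b)%N) /= [X in _ + X]big_nat_cond.
  rewrite [X in _ + X]big1 ?addr0; last first.
    move=> b /andP[/andP[b0 _] pb]; rewrite lognE pp b0 (negPf pb) /=.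
    by rewrite mul0r mulr0.
  apply: (@ler_sum_inj2 _ _ _ _ _ _ _ _ (fun v m => (p ^ v)%:R <= x / m%:R)
    (logn p) (fun n => n`_p^')%N); rewrite ?iota_uniq //.
  - move=> b; rewrite !mem_index_iota => /andP[b1 bN] pb.
    rewrite (leq_trans (ltn_logl p b1)) ?(ltnW bN) // part_gt0 /=.
    rewrite logn_gt0 mem_primes pp b1 pb; split => //.
      by rewrite (leq_ltn_trans _ bN) // dvdn_leq // dvdn_part.
    rewrite ler_pdivlMr ?ltr0n ?part_gt0 // -natrM -p_part partnC //.
    by rewrite -xN.
  - move=> m n; rewrite !inE !mem_index_iota => /andP[/andP[m1 _] _] /andP[/andP[n1 _] _].
    move=> e1 e2; rewrite -(partnC p m1) -(partnC p n1) !p_part e1.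
    by congr muln.
  - move=> b; rewrite mem_index_iota => /andP[b1 bN] pb; rewrite /T.
    set m := (b`_p^')%N; set v := logn p b.
    have m0 : (0 < m)%N by rewrite part_gt0.
    have bE : b = (p ^ v * m)%N by rewrite /v /m -p_part partnC.
    have -> : (p ^ v)%:R / (x / m%:R) = b%:R / x :> R.
      by rewrite invf_div mulrA -natrM -bE.
    move: ((b%:R / x) `^ d) (powR_ge0 (b%:R / x) d) => u u0.
    have -> : F m * (F (p ^ v)%N * (v%:R * ln p%:R) * u) =
        F (p ^ v)%N * F m * (u * (v%:R * ln p%:R)) by ring.
    rewrite -[leLHS]mulrA ler_wpM2r ?mulr_ge0 ?ln_ge0 ?ler1n //.
    rewrite {1}bE; apply: FM; rewrite ?expn_gt0 ?p0 //.
    by rewrite /m -p_part coprime_partC.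
  - move=> v m; rewrite !mem_index_iota => /andP[v1 _] /andP[m1 _] _.
    by rewrite /T !mulr_ge0 ?powR_ge0 ?ln_ge0 ?ler1n.
apply: (@le_trans _ _ (\sum_(1 <= m < N.+1) F m * \sum_(0 <= p < N.+1 | prime p)
   \sum_(1 <= v < N.+1 | (p ^ v)%:R <= x / m%:R)
     F (p ^ v)%N * (v%:R * ln p%:R) * ((p ^ v)%:R / (x / m%:R)) `^ d)).
  rewrite le_eqVlt; apply/orP; left; apply/eqP.
  under [RHS]eq_bigr do rewrite mulr_sumr.
  rewrite [RHS]exchange_big /=; apply: eq_bigr => p pp.
  under [RHS]eq_bigr do rewrite mulr_sumr big_mkcond.
  rewrite [RHS]exchange_big /=; apply: eq_bigr => v _.
  by rewrite [LHS]big_mkcond.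
rewrite mulr_sumr big_nat [leRHS]big_nat; apply: ler_sum => m /andP[m1 mN].
rewrite mulrC ler_wpM2r //; apply: HG.
have m0 : 0 < m%:R :> R by rewrite ltr0n.
by rewrite ler_pdivlMr // mul1r -xN -ltnS mN /= ler_pdivrMr // ler_pMr // ler1n.
Qed.

End EulerProducts.

(** * Divisor functions and sums over prime powers *)

(** A tuple with product p^v is determined by its exponents, each at most [v]. The bound on [f] by
    [tau] enters the estimate only through this crude count. *)
Lemma tau_prime_power k p v : prime p -> (tau k (p ^ v) <= v.+1 ^ k)%N.
Proof.
move=> pp; rewrite /tau; set D := [set _ | _].
have Dpow t i : t \in D -> (t i : nat) = (p ^ logn p (t i))%N /\ (logn p (t i) <= v)%N.
  rewrite inE => /andP[/forallP t0 /eqP tE].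
  have tv : (t i %| \prod_(j < k) t j)%N by rewrite (bigD1 i) //= dvdn_mulr.
  move: tv; rewrite tE => /(dvdn_pfactor _ _ pp)[w wv tw].
  by rewrite tw pfactorK.
pose e (t : {ffun 'I_k -> 'I_(p ^ v).+1}) : {ffun 'I_k -> 'I_v.+1} :=
  [ffun i => inord (logn p (t i))].
have einj : {in D &, injective e}.
  move=> t t' tD tD' /ffunP ett'; apply/ffunP => i; apply: val_inj => /=.
  have := congr1 val (ett' i); rewrite !ffunE /=.
  have [e1 l1] := Dpow t i tD; have [e2 l2] := Dpow t' i tD'.
  by rewrite !inordK // => el; rewrite e1 e2 el.
rewrite -(card_in_imset einj).
by apply: leq_trans (max_card _) _; rewrite card_ffun !card_ord.
Qed.

Section PrimePowers.
Variable R : realType.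
Implicit Types (x d : R).

Lemma sum_geometric34 N : \sum_(0 <= v < N) (3 / 4) ^+ v <= 4 :> R.
Proof.
have -> : \sum_(0 <= v < N) (3 / 4) ^+ v = 4 - 4 * (3 / 4) ^+ N :> R.
  elim: N => [|N IH]; first by rewrite big_geq // expr0; ring.
  by rewrite big_nat_recr //= IH exprS; field.
by rewrite gerBl mulr_ge0 // exprn_ge0 // divr_ge0.
Qed.

Lemma sum_prime_power_tail k : exists2 C : R, 0 < C & forall N p, (1 < p)%N ->
  \sum_(2 <= v < N.+1) v.+1%:R ^+ k / (p ^ v)%:R <= C / p%:R ^+ 2.
Proof.
pose A : R := (4 * k.+1%:R) ^+ k.
have A0 : 0 < A by rewrite exprn_gt0 // mulr_gt0.
(* From t <= e^t at t = (v+1) / (4(k+1)) one gets (v+1)^k <= A (3/2)^(v+1), while p^(-v) <= 4 *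
   2^(-v) / p^2 for v >= 2. The terms are at most 6A (3/4)^v / p^2, and the geometric series sums to
   at most 4. *)
exists (24 * A) => [|N p p1]; first by rewrite mulr_gt0.
have p0 : 0 < p%:R :> R by rewrite ltr0n ltnW.
have e14 : expR (4^-1) <= 3 / 2 :> R.
  have := @le_ln1Dx R (- 3^-1) ltac:(lra).
  have -> : 1 + - 3^-1 = (3 / 2)^-1 :> R by field.
  rewrite lnV ?posrE ?divr_gt0 // => h.
  rewrite -[leRHS](@lnK R) ?posrE ?divr_gt0 // ler_expR; lra.
have poly v : v.+1%:R ^+ k <= A * (3 / 2) * (3 / 2) ^+ v :> R.
  set c : R := 4 * k.+1%:R.
  have c0 : 0 < c by rewrite mulr_gt0.
  apply: (@le_trans _ _ ((c * expR (v.+1%:R / c)) ^+ k)).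
    rewrite lerXn2r ?nnegrE ?mulr_ge0 ?expR_ge0 ?(ltW c0) //.
    rewrite mulrC -ler_pdivrMr //.
    by have := expR_ge1Dx (v.+1%:R / c); lra.
  rewrite exprMn -/A -mulrA ler_pM2l // -exprS -expRM_natl.
  apply: (@le_trans _ _ (expR (4^-1) ^+ v.+1)); last by rewrite lerXn2r ?nnegrE ?expR_ge0 ?divr_ge0.
  rewrite -expRM_natl ler_expR mulrCA ler_pM2l ?ltr0n // ler_pdivrMr //.
  rewrite /c mulrA mulVf ?pnatr_eq0 // mul1r ler_nat //.
apply: (@le_trans _ _ (\sum_(2 <= v < N.+1) (6 * A / p%:R ^+ 2) * (3 / 4) ^+ v)).
  rewrite big_nat [leRHS]big_nat; apply: ler_sum => v /andP[v2 _].
  have q0 : 0 < (p ^ v)%:R :> R by rewrite ltr0n expn_gt0 ltnW.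
  have pv : (4 * 2 ^+ v)^-1 * 16 / p%:R ^+ 2 >= (p ^ v)%:R^-1 :> R.
    rewrite -(subnK v2) addnC natrX exprD exprD; move: (v - 2)%N => w.
    have -> : (4 * (2 ^+ 2 * 2 ^+ w))^-1 * 16 / p%:R ^+ 2 = (p%:R ^+ 2 * 2 ^+ w)^-1 :> R.
      by field; rewrite ?expf_neq0 ?pnatr_eq0 // -lt0n ltnW.
    rewrite lef_pV2 ?posrE ?mulr_gt0 ?exprn_gt0 //.
    by rewrite ler_pM2l ?exprn_gt0 // lerXn2r ?nnegrE // ler_nat.
  apply: (@le_trans _ _ (A * (3 / 2) * (3 / 2) ^+ v * ((4 * 2 ^+ v)^-1 * 16 / p%:R ^+ 2))).
    by apply: ler_pM; rewrite ?invr_ge0 ?exprn_ge0.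
  rewrite le_eqVlt; apply/orP; left; apply/eqP.
  have -> : 3 / 4 = (3 / 2) / 2 :> R by field.
  rewrite [X in _ = _ * X]expr_div_n.
  move: ((3 / 2) ^+ v) => u; field.
  by rewrite ?expf_neq0 ?pnatr_eq0 // -lt0n ltnW.
rewrite -mulr_sumr.
apply: (@le_trans _ _ (6 * A / p%:R ^+ 2 * 4)).
  apply: ler_wpM2l; first by rewrite divr_ge0 ?mulr_ge0 ?exprn_ge0 // ltW.
  apply: le_trans (sum_geometric34 N.+1).
  have [N1|N1] := leqP N.+1 2.
    by rewrite big_geq // sumr_ge0 // => v _; rewrite exprn_ge0 // divr_ge0.
  rewrite [leRHS](@big_cat_nat _ _ _ 2) //= ?(ltnW N1) // lerDr.
  by rewrite sumr_ge0 // => v _; rewrite exprn_ge0 // divr_ge0.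
by rewrite le_eqVlt; apply/orP; left; apply/eqP; ring.
Qed.

Lemma sum_primes_inv_sqr N : \sum_(0 <= p < N.+1 | prime p) (p%:R ^+ 2)^-1 <= 2 :> R.
Proof.
apply: le_trans (sum_primes_le_sum _ _ _ _) _ => [n|].
  by rewrite invr_ge0 exprn_ge0.
have := sum_powR_le R N 1 ltr01; rewrite invr1; apply: le_trans.
by apply: ler_sum => n _; rewrite powRN [1 + 1](_ : _ = 2%:R) ?powR_mulrn.
Qed.

(** Since ln p <= 2 sqrt p, the terms are at most 2 p^(-3/2). *)
Lemma sum_primes_ln_sqr N :
  \sum_(0 <= p < N.+1 | prime p) ln p%:R / p%:R ^+ 2 <= 6 :> R.
Proof.
apply: (@le_trans _ _ (\sum_(0 <= p < N.+1 | prime p) 2 * p%:R `^ (- (1 + 2^-1)))).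
  apply: ler_sum => p pp; have p0 : 0 < p%:R :> R by rewrite ltr0n prime_gt0.
  have -> : - (1 + 2^-1) = 2^-1 - 2%:R :> R by lra.
  rewrite powRB; last by rewrite (gt_eqF p0) implybT.
  rewrite powR_mulrn ?(ltW p0) // mulrA ler_wpM2r ?invr_ge0 ?exprn_ge0 ?(ltW p0) //.
  have h : ln p%:R = 2 * ln (p%:R `^ 2^-1) :> R.
    by rewrite ln_powR mulrA divff ?mul1r.
  by rewrite h ler_pM2l // ltW // ln_sublinear // powR_gt0.
rewrite -mulr_sumr; have -> : 6 = 2 * 3 :> R by lra.
rewrite ler_pM2l //; apply: le_trans (sum_primes_le_sum _ _ _ _) _ => [n|].
  exact: powR_ge0.
have := sum_powR_le R N 2^-1 ltac:(by rewrite invr_gt0); rewrite invrK.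
by rewrite (_ : 1 + 2 = 3 :> R) //; lra.
Qed.

(** Supplies the hypothesis on [G] in [sum_ln_weighted]. The first powers need the damping factor
    and the weighted Chebyshev bound. For v >= 2 that factor is at most 1 and is dropped; the extra
    [v] raises the exponent to [k.+1], and the convergent remainder is absorbed by 1/d >= 1. *)
Lemma sum_prime_powers_weighted k : exists2 C : R, 0 < C &
  forall (F : nat -> R) x d Z,
    0 < d <= 1 -> 1 <= Z <= x ->
    (forall n, 0 <= F n) ->
    (forall p v, prime p -> (0 < v)%N -> F (p ^ v)%N <= v.+1%:R ^+ k / (p ^ v)%:R) ->
  \sum_(0 <= p < (Num.truncn x).+1 | prime p)
    \sum_(1 <= v < (Num.truncn x).+1 | (p ^ v)%:R <= Z)
      F (p ^ v)%N * (v%:R * ln p%:R) * ((p ^ v)%:R / Z) `^ d <= C / d.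
Proof.
have [C C0 HC] := sum_prime_power_tail k.+1.
exists (2 ^+ k * 8 + 6 * C) => [|F x d Z /andP[d0 d1] /andP[Z1 Zx] F0 FB].
  by rewrite addr_gt0 ?mulr_gt0 ?exprn_gt0.
have Z0 : 0 < Z by lra.
have x0 : 0 < x by lra.
set N := Num.truncn x.
have N1 : (0 < N)%N by rewrite /N truncn_ge_nat ?(ltW x0) //; lra.
have lnp p : prime p -> 0 <= ln p%:R :> R.
  by move=> pp; rewrite ln_ge0 // ler1n prime_gt0.
apply: (@le_trans _ _ (\sum_(0 <= p < N.+1 | prime p)
   ((if p%:R <= Z then 2 ^+ k * (ln p%:R / p%:R * (p%:R / Z) `^ d) else 0) +
    C * (ln p%:R / p%:R ^+ 2)))).
  apply: ler_sum => p pp; have p0 : 0 < p%:R :> R by rewrite ltr0n prime_gt0.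
  rewrite big_mkcond big_ltn ?ltnS //= expn1; apply: lerD.
    case: ifP => // _; rewrite mul1r !mulrA; apply: ler_wpM2r; first exact: powR_ge0.
    rewrite mulrAC; apply: ler_wpM2r; first exact: lnp.
    by have := FB p 1%N pp isT; rewrite expn1.
  apply: (@le_trans _ _ (\sum_(2 <= v < N.+1) (v.+1%:R ^+ k.+1 / (p ^ v)%:R) * ln p%:R)).
    rewrite big_nat [leRHS]big_nat; apply: ler_sum => v /andP[v2 _].
    have q0 : 0 < (p ^ v)%:R :> R by rewrite ltr0n expn_gt0 prime_gt0.
    case: ifP => [pvZ|_]; last first.
      by rewrite mulr_ge0 ?lnp // divr_ge0 ?exprn_ge0 ?(ltW q0).
    have w1 : ((p ^ v)%:R / Z) `^ d <= 1.
      rewrite -[leRHS](_ : 1 `^ d = 1); last by rewrite powR1.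
      apply: ge0_ler_powR; rewrite ?nnegrE ?(ltW d0) //.
        by rewrite divr_ge0 // ltW.
      by rewrite ler_pdivrMr // mul1r.
    apply: (@le_trans _ _ (F (p ^ v)%N * (v%:R * ln p%:R))).
      by apply: ler_piMr => //; rewrite !mulr_ge0 ?lnp.
    rewrite mulrA; apply: ler_wpM2r; first exact: lnp.
    rewrite exprSr mulrAC; apply: ler_pM => //; last by rewrite ler_nat.
    by apply: FB => //; apply: ltnW.
  rewrite -mulr_suml [leRHS]mulrCA [leRHS]mulrC ler_wpM2r ?lnp //.
  exact: HC (prime_gt1 pp).
rewrite big_split /= -mulr_sumr mulrDl; apply: lerD; last first.
  rewrite [6 * C]mulrC -mulrA ler_pM2l //.
  apply: (le_trans (sum_primes_ln_sqr N)).
  by rewrite ler_pdivlMr //; lra.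
rewrite -big_mkcondr /= -mulr_sumr -mulrA ler_pM2l ?exprn_gt0 //.
apply: le_trans (sum_ln_primes_weighted R d Z _ Z1); last by rewrite d0.
rewrite le_eqVlt; apply/orP; left; apply/eqP.
have ZN : (Num.truncn Z <= N)%N.
  by rewrite /N truncn_ge_nat ?(ltW x0) // (le_trans _ Zx) // truncn_le ltW.
rewrite [RHS](big_nat_widen _ _ N.+1) //; apply: eq_bigl => p.
by rewrite ltnS truncn_ge_nat ?(ltW Z0).
Qed.

(** Each Euler factor is at most 1 + F p + C/p^2, hence at most exp (F p + C/p^2). The value [F p]
    is kept exact, because its vanishing on (K, y] produces the factor e^(-L). *)
Lemma sum_le_expR_primes k : exists C : R,
  forall (F : nat -> R) N,
    (forall n, 0 <= F n) -> F 1%N <= 1 ->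
    (forall m n, (0 < m)%N -> (0 < n)%N -> coprime m n -> F (m * n)%N <= F m * F n) ->
    (forall p v, prime p -> (0 < v)%N -> F (p ^ v)%N <= v.+1%:R ^+ k / (p ^ v)%:R) ->
  \sum_(1 <= n < N.+1) F n <=
  expR C * expR (\sum_(0 <= p < N.+1 | prime p) F p).
Proof.
have [C C0 HC] := sum_prime_power_tail k.
exists (C * 2) => F N F0 F1 FM FB.
apply: (le_trans (sum_le_euler_product R F N F0 F1 FM)).
apply: (@le_trans _ _ (expR (\sum_(0 <= p < N.+1 | prime p) (C / p%:R ^+ 2 + F p)))); last first.
  rewrite -expRD ler_expR big_split /= lerD2r -mulr_sumr ler_pM2l //.
  exact: sum_primes_inv_sqr.
rewrite expR_sum big_nat_cond [leRHS]big_nat_cond.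
apply: ler_prod => p /andP[/andP[_ pN] pp].
rewrite sumr_ge0 //=.
apply: le_trans (expR_ge1Dx _).
rewrite big_ltn // big_ltn; last by rewrite (leq_trans (prime_gt1 pp)) // ltnW.
rewrite expn0 expn1; apply: lerD => //; rewrite addrC; apply: lerD => //.
apply: le_trans (HC N p (prime_gt1 pp)).
rewrite big_nat [leRHS]big_nat; apply: ler_sum => v /andP[v2 _].
by apply: FB => //; apply: ltnW.
Qed.

End PrimePowers.

(** * Splitting off the primes that divide exactly once *)

(** The squarefree factor [s] is stored as its set of primes inside a finite type, as Sperner's
    theorem requires; [logn p a == 1%N] forces [p] to be prime. *)
Definition simple_primes (K Y a : nat) : {set 'I_Y.+1} :=
  [set p : 'I_Y.+1 | (K < p)%N && (logn p a == 1%N)].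

Definition simple_pred (K Y a : nat) : nat_pred :=
  [pred p | (K < p <= Y)%N && (logn p a == 1%N)].

Definition cosimple_part (K Y a : nat) : nat := (a`_(simple_pred K Y a)^')%N.

Definition no_simple (K Y b : nat) : bool :=
  [forall p : 'I_Y.+1, (K < p)%N ==> (logn p b != 1%N)].

Section SimplePrimes.
Variables K Y : nat.

Lemma logn1_prime p a : logn p a = 1%N -> prime p.
Proof. by rewrite lognE; case: prime. Qed.

Lemma simple_primes_prime a (p : 'I_Y.+1) :
  p \in simple_primes K Y a -> prime p && (K < p)%N.
Proof. by rewrite inE => /andP[-> /eqP/logn1_prime ->]. Qed.

Lemma simple_part_prod a :
  (a`_(simple_pred K Y a) = \prod_(p in simple_primes K Y a) (p : nat))%N.
Proof.
rewrite (@widen_partn (a + Y)) ?leq_addr //.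
transitivity (\prod_(0 <= p < Y.+1 | p \in simple_pred K Y a) p)%N; last first.
  rewrite big_mkord; apply: eq_bigl => p; rewrite !inE.
  by rewrite -(ltnS p) ltn_ord andbT.
rewrite [RHS](big_nat_widen _ _ (a + Y).+1) ?ltnS ?leq_addl //.
rewrite big_mkcond [RHS]big_mkcond; apply: eq_bigr => p _.
rewrite !inE ltnS; case: andP => [[/andP[_ ->] /eqP ->]|//]; exact: expn1.
Qed.

Lemma cosimple_partE a : (0 < a)%N ->
  a = (cosimple_part K Y a * \prod_(p in simple_primes K Y a) (p : nat))%N.
Proof. by move=> a0; rewrite -simple_part_prod mulnC partnC. Qed.

Lemma coprime_cosimple_part a :
  coprime (cosimple_part K Y a) (\prod_(p in simple_primes K Y a) (p : nat)).
Proof. by rewrite -simple_part_prod coprime_sym coprime_partC. Qed.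

Lemma cosimple_part_bounds a : (0 < a)%N -> (0 < cosimple_part K Y a <= a)%N.
Proof. by move=> a0; rewrite part_gt0 dvdn_leq // dvdn_part. Qed.

(** As [b] is coprime to [s], a prime dividing [b] exactly once also divides [a] exactly once, so it
    would have been moved to [s]. *)
Lemma no_simple_cosimple_part a : (0 < a)%N -> no_simple K Y (cosimple_part K Y a).
Proof.
move=> a0; apply/forallP => p; apply/implyP => Kp; apply/negP => /eqP l1.
have pp := logn1_prime _ _ l1.
have pn : (p : nat) \in primes (cosimple_part K Y a) by rewrite -logn_gt0 l1.
have : (p : nat) \notin simple_pred K Y a.
  by move: pn; rewrite primes_part mem_filter => /andP[].
rewrite !inE Kp -ltnS ltn_ord /= => /eqP; apply.
rewrite -l1 {1}(cosimple_partE a a0) mulnC logn_Gauss //.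
rewrite prime_coprime //; apply/negP => pd.
have := coprime_cosimple_part a; rewrite /coprime => /eqP g1.
have : (p %| gcdn (cosimple_part K Y a) (\prod_(q in simple_primes K Y a) q))%N.
  by rewrite dvdn_gcd pd andbT; move: pn; rewrite mem_primes => /and3P[].
by rewrite g1 Euclid_dvd1.
Qed.

Lemma no_simpleM m n : (0 < m)%N -> (0 < n)%N -> coprime m n ->
  no_simple K Y (m * n) -> no_simple K Y m && no_simple K Y n.
Proof.
move=> m0 n0 mn /forallP H.
have aux a b (p : 'I_Y.+1) : coprime a b -> logn p a = 1%N -> logn p (a * b) = 1%N.
  move=> ab la; have pp := logn1_prime _ _ la.
  rewrite mulnC logn_Gauss //.
  have pa : (p %| a)%N.
    have : (p : nat) \in primes a by rewrite -logn_gt0 la.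
    by rewrite mem_primes => /and3P[].
  exact: coprime_dvdl pa ab.
apply/andP; split; apply/forallP => p; apply/implyP => Kp; apply/negP => /eqP l1;
  have := H p; rewrite Kp /= => /eqP; apply.
- exact: aux.
- by rewrite mulnC; apply: aux; rewrite // coprime_sym.
Qed.

(* Members of a primitive set with a common cosimple part differ only by their
   simple primes, so divisibility becomes inclusion. *)
Lemma antichain_simple (A : pred nat) b : (0 < b)%N ->
    (forall a c, A a -> A c -> a <> c -> ~~ (a %| c)%N) ->
  antichain _ [set S : {set 'I_Y.+1} |
    A (b * \prod_(p in S) (p : nat))%N && [forall p in S, (1 < p)%N]].
Proof.
move=> b0 Aprim S S'; rewrite !inE => /andP[AS _] /andP[AS' /forall_inP S'1] SS'.
have split_prod : (\prod_(p in S') (p : nat) =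
    (\prod_(p in S) (p : nat)) * \prod_(p in S' :\: S) (p : nat))%N.
  by rewrite (big_setID S) /= (finset.setIidPr SS').
have P0 : (0 < \prod_(p in S) (p : nat))%N.
  rewrite prodn_cond_gt0 // => p pS; apply: ltnW; apply: S'1.
  exact: (fintype.subsetP SS').
apply/eqP; rewrite finset.eqEsubset SS' -finset.setD_eq0 /=.
(* Distinct products would be two members of [A], one dividing the other. Equal ones force the
   product over [S' :\: S] to be 1, and its elements exceed 1. *)
have [E|/eqP NE] := eqVneq (b * \prod_(p in S) (p : nat))%N
    (b * \prod_(p in S') (p : nat))%N; last first.
  by have := Aprim _ _ AS AS' NE; rewrite split_prod mulnA dvdn_mulr.
have : (\prod_(p in S' :\: S) (p : nat) = 1)%N.
  move: E; rewrite split_prod mulnA => /eqP.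
  by rewrite -{1}[(b * _)%N]muln1 eqn_pmul2l ?muln_gt0 ?b0 // eq_sym => /eqP.
move=> prod1; apply: contraT => /finset.set0Pn[p pS].
have /S'1 : p \in S' by move: pS; rewrite inE => /andP[].
rewrite ltnNge => /negP[].
by apply: dvdn_leq; rewrite // -[X in (_ %| X)%N]prod1 (bigD1 p) //= dvdn_mulr.
Qed.

End SimplePrimes.

(** * Multiplicative weights on the cofactors *)

Section MultiplicativeFunctions.
Variables (R : realType) (f : nat -> R).
Hypothesis f1 : f 1%N = 1.
Hypothesis fM : forall m n, (0 < m)%N -> (0 < n)%N -> coprime m n ->
  f (m * n)%N = f m * f n.

Lemma mult_prod_primes (s : seq nat) : uniq s -> all prime s ->
  f (\prod_(p <- s) p)%N = \prod_(p <- s) f p.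
Proof.
elim: s => [|p s IH] /=; first by rewrite !big_nil.
move=> /andP[ps us] /andP[pp prs]; rewrite !big_cons fM ?IH ?(prime_gt0 pp) //.
  by rewrite big_seq prodn_cond_gt0 // => q /(allP prs)/prime_gt0.
exact: coprime_prod_primes.
Qed.

Lemma mult_prod_set Y (S : {set 'I_Y.+1}) : {in S, forall p : 'I_Y.+1, prime p} ->
  f (\prod_(p in S) (p : nat))%N = \prod_(p in S) f p.
Proof.
move=> Sp.
have e1 : (\prod_(p in S) (p : nat) = \prod_(p <- map val (enum S)) p)%N.
  by rewrite big_map big_enum.
have e2 : \prod_(p in S) f p = \prod_(p <- map val (enum S)) f p.
  by rewrite big_map big_enum.
have us : uniq (map val (enum S)) by rewrite (map_inj_uniq val_inj) enum_uniq.
rewrite e1 e2 mult_prod_primes //.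
by apply/allP => _ /mapP[p + ->]; rewrite mem_enum => /Sp.
Qed.

Variables (K Y k : nat).
Hypothesis f0 : forall n, (0 < n)%N -> 0 <= f n.
Hypothesis fB : forall p v, prime p -> f (p ^ v)%N <= v.+1%:R ^+ k.

(** The value 0 at b = 0 makes the weight nonnegative everywhere, although [f 0] is
    unconstrained. *)
Definition cosimple_weight b : R :=
  if (0 < b)%N && no_simple K Y b then f b / b%:R else 0.

Lemma cosimple_weight_ge0 b : 0 <= cosimple_weight b.
Proof. by rewrite /cosimple_weight; case: andP => // -[b0 _]; rewrite divr_ge0 ?f0. Qed.

Lemma cosimple_weight1 : cosimple_weight 1 <= 1.
Proof. by rewrite /cosimple_weight; case: ifP => //; rewrite f1 divr1. Qed.

Lemma cosimple_weightM m n : (0 < m)%N -> (0 < n)%N -> coprime m n ->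
  cosimple_weight (m * n)%N <= cosimple_weight m * cosimple_weight n.
Proof.
move=> m0 n0 mn; rewrite {1}/cosimple_weight; case: andP => [[_ H]|_]; last first.
  by rewrite mulr_ge0 ?cosimple_weight_ge0.
have /andP[Hm Hn] := no_simpleM _ _ _ _ m0 n0 mn H.
by rewrite /cosimple_weight m0 n0 Hm Hn /= fM // natrM invfM mulrACA.
Qed.

Lemma cosimple_weight_pp p v : prime p -> (0 < v)%N ->
  cosimple_weight (p ^ v)%N <= v.+1%:R ^+ k / (p ^ v)%:R.
Proof.
move=> pp v0; rewrite /cosimple_weight; case: ifP => _; last by rewrite divr_ge0 ?exprn_ge0.
by rewrite ler_wpM2r ?invr_ge0 // fB.
Qed.

(** For K < p <= Y the weight vanishes, as [p] divides itself exactly once. Only primes up to [K]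
    can be counted twice, with surplus at most 2^k. *)
Lemma cosimple_weight_prime p : prime p ->
  cosimple_weight p + (if (p <= Y)%N then f p / p%:R else 0) <=
  f p / p%:R + (if (p <= K)%N then 2 ^+ k else 0).
Proof.
move=> pp; have p0 := prime_gt0 pp.
have fp0 : 0 <= f p / p%:R by rewrite divr_ge0 ?f0.
have fpk : f p / p%:R <= 2 ^+ k.
  have h := fB p 1 pp; rewrite expn1 in h; apply: le_trans h.
  by rewrite ler_pdivrMr ?ltr0n // ler_peMr ?f0 // ler1n.
have k0 : 0 <= 2 ^+ k :> R by rewrite exprn_ge0.
have w : cosimple_weight p <= f p / p%:R by rewrite /cosimple_weight; case: ifP.
have [pK|Kp] := leqP p K; case: leqP => pY; try lra.
rewrite /cosimple_weight p0 /=.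
case: ifP => [/forallP H|_]; last by lra.
have pYo : (p < Y.+1)%N by [].
by have := H (Ordinal pYo); rewrite /= Kp lognE pp p0 dvdnn divnn p0 logn1.
Qed.

End MultiplicativeFunctions.

(** * The estimate for one primitive set *)

Section PrimitiveSums.
Variables (R : realType) (k : nat) (z y : R) (A : pred nat) (f : nat -> R).
Hypotheses (y2 : 2 <= y) (yz : y <= z).
Hypothesis A0 : forall a, A a -> (0 < a)%N.
Hypothesis Aprim : forall a b, A a -> A b -> a <> b -> ~~ (a %| b)%N.
Hypothesis f1 : f 1%N = 1.
Hypothesis fM : forall m n, (0 < m)%N -> (0 < n)%N -> coprime m n ->
  f (m * n)%N = f m * f n.
Hypothesis f0 : forall n, (0 < n)%N -> 0 <= f n.
Hypothesis fB : forall p v, prime p -> f (p ^ v)%N <= v.+1%:R ^+ k.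

Let Y := Num.truncn y.
Let N := Num.truncn z.
(* For [p > K] the weights [rankin_weight p] below are at most [1]. *)
Let K := (2 ^ k.+1)%N.
(* Chosen so that [y `^ d = 2]. *)
Let d : R := ln 2 / ln y.
Let F := cosimple_weight R f K Y.

Definition rankin_weight (p : nat) : R :=
  if prime p && (K < p)%N then f p * p%:R `^ d / p%:R else 0.

Let L := \sum_(0 <= p < Y.+1 | prime p) f p / p%:R.
Let Lam := \sum_(p < Y.+1) rankin_weight p.
(* Bounds the contribution of the primes up to [K] to sums of [f p / p]. *)
Let c1 : R := K.+1%:R * 2 ^+ k.

Let y0 : 0 < y. Proof. by move: y2; lra. Qed.
Let z0 : 0 < z. Proof. exact: lt_le_trans y0 yz. Qed.
Let lny_ge : (2^-1 : R) <= ln 2 <= ln y.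
Proof. by rewrite ln2_ge_half /= ler_ln ?posrE. Qed.
Let lny0 : 0 < ln y. Proof. by have /andP[] := lny_ge; lra. Qed.
Let d0 : 0 < d. Proof. by rewrite divr_gt0 //; have /andP[] := lny_ge; lra. Qed.
Let dV : d^-1 <= 2 * ln y.
Proof.
have /andP[l2 _] := lny_ge.
by rewrite invf_div ler_pdivrMr; [move: lny0; nra | lra].
Qed.
Let yd : y `^ d = 2.
Proof. by rewrite powR_expR // /d divfK ?gt_eqF // lnK ?posrE. Qed.
Let le_Y p : (p <= Y)%N = (p%:R <= y).
Proof. by rewrite truncn_ge_nat // ltW. Qed.
Let le_N p : (p <= N)%N = (p%:R <= z).
Proof. by rewrite truncn_ge_nat // ltW. Qed.

(** These weights serve as probabilities: p <= y gives p^d <= y^d = 2, so the numerator is at most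
    2^k * 2 = K < p. *)
Lemma rankin_weight_bounds (p : 'I_Y.+1) : 0 <= rankin_weight p <= 1.
Proof.
rewrite /rankin_weight; case: ifP => [/andP[pp Kp]|_]; last by rewrite lexx ler01.
have p0 : 0 < (p : nat)%:R :> R by rewrite ltr0n prime_gt0.
have fp0 := f0 p (prime_gt0 pp).
rewrite divr_ge0 ?mulr_ge0 ?powR_ge0 ?(ltW p0) //=.
rewrite ler_pdivrMr // mul1r.
have h := fB p 1 pp; rewrite expn1 in h.
apply: (@le_trans _ _ (2 ^+ k * 2)).
  apply: ler_pM => //.
  rewrite -yd; apply: ge0_ler_powR; rewrite ?nnegrE ?(ltW d0) ?(ltW y0) ?(ltW p0) //.
  by rewrite -le_Y -ltnS.
by rewrite -exprSr -natrX ler_nat ltnW.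
Qed.

Lemma weight_le_cosimple a : (0 < a)%N -> z / y <= a%:R <= z ->
  f a / a%:R * ln z <= F (cosimple_part K Y a) *
    (3 * ln y + 2 * ((cosimple_part K Y a)%:R / z) `^ d * ln (cosimple_part K Y a)%:R) *
    \prod_(p in simple_primes K Y a) rankin_weight p.
Proof.
move=> a0 /andP[za az]; set b := cosimple_part K Y a.
set s := (\prod_(p in simple_primes K Y a) (p : nat))%N.
have aE : a = (b * s)%N := cosimple_partE K Y a a0.
have /andP[b0 _] := cosimple_part_bounds K Y a a0.
have s0 : (0 < s)%N by move: a0; rewrite aE muln_gt0 => /andP[].
have Sp : {in simple_primes K Y a, forall p : 'I_Y.+1, prime p}.
  by move=> p /simple_primes_prime/andP[].
have FE : F b = f b / b%:R.
  by rewrite /F /cosimple_weight b0 no_simple_cosimple_part.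
have RE : \prod_(p in simple_primes K Y a) rankin_weight p = f s / s%:R * s%:R `^ d.
  pose g n : R := n%:R `^ d.
  have gM m n : (0 < m)%N -> (0 < n)%N -> coprime m n -> g (m * n)%N = g m * g n.
    by move=> _ _ _; rewrite /g natrM powRM.
  have g1 : g 1%N = 1 by rewrite /g powR1.
  rewrite /s (mult_prod_set R f f1 fM) // -/(g _) (mult_prod_set R g g1 gM) //.
  rewrite natr_prod -prodf_div -big_split /=; apply: eq_bigr => p pS.
  by rewrite /rankin_weight (simple_primes_prime _ _ _ _ pS) mulrAC.
rewrite FE RE.
have -> : f a / a%:R = f b / b%:R * (f s / s%:R).
  rewrite aE fM ?natrM ?invfM 1?mulrACA //; exact: coprime_cosimple_part.
have X0 : 0 <= f b / b%:R by rewrite divr_ge0 ?f0.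
have W0 : 0 <= f s / s%:R by rewrite divr_ge0 ?f0.
set t := s%:R `^ d; have t1 : 1 <= t by apply: powR_ge1_nat => //; exact: ltW.
suff main : ln z <= (3 * ln y + 2 * (b%:R / z) `^ d * ln b%:R) * t.
  rewrite -mulrA -[leRHS]mulrA ler_wpM2l //.
  by rewrite mulrCA ler_wpM2l.
have br0 : 0 < b%:R :> R by rewrite ltr0n.
have sr0 : 0 < s%:R :> R by rewrite ltr0n.
have ar0 : 0 < a%:R :> R by rewrite ltr0n.
have lnz : ln z <= ln y + (ln b%:R + ln s%:R).
  rewrite -lnM ?posrE // -natrM -aE -lnM ?posrE //.
  by rewrite ler_ln ?posrE ?mulr_gt0 // mulrC -ler_pdivrMr.
(* This is u <= e^u at u = d ln s, followed by 1/d <= 2 ln y. *)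
have lns : ln s%:R <= 2 * ln y * t.
  apply: (@le_trans _ _ (d^-1 * t)); last by rewrite ler_wpM2r //; lra.
  rewrite mulrC ler_pdivlMr // mulrC /t powR_expR //.
  by have := expR_ge1Dx (d * ln s%:R); lra.
(* From a >= z/y, the number y(a/z) is at least 1; raise it to the power [d]. As a = bs, the factor
   s^d joins the Sperner weight and (b/z)^d stays with the sum over [b]. *)
have half : 1 <= 2 * (b%:R / z) `^ d * t.
  rewrite -mulrA /t -powRM ?divr_ge0 ?(ltW br0) ?(ltW z0) ?(ltW sr0) //.
  rewrite mulrAC -natrM -aE -yd -powRM ?divr_ge0 ?(ltW y0) ?(ltW z0) //.
  rewrite -[leLHS](_ : 1 `^ d = 1); last by rewrite powR1.
  apply: ge0_ler_powR; rewrite ?nnegrE ?ler01 ?(ltW d0) //.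
    by rewrite mulr_ge0 ?divr_ge0 ?(ltW y0) ?(ltW z0).
  by rewrite mulrA ler_pdivlMr // mul1r mulrC -ler_pdivrMr.
have lnb0 : 0 <= ln (b%:R : R) by rewrite ln_ge0 // ler1n.
apply: (le_trans lnz).
have := ler_wpM2r lnb0 half; rewrite mul1r => hb.
have ht : ln y <= ln y * t by rewrite ler_peMr // ltW.
move: ((b%:R / z) `^ d) (ln b%:R) hb => u v hb.
have -> : (3 * ln y + 2 * u * v) * t = ln y * t + (2 * u * t * v + 2 * ln y * t) by ring.
by rewrite lerD // lerD.
Qed.

Lemma sum_primitive_le :
  (\sum_(0 <= a < N.+1 | A a && (z / y <= a%:R)) f a / a%:R) * ln z <=
  3 * expR Lam / Num.sqrt (Lam + 1) *
  \sum_(1 <= b < N.+1) F b * (3 * ln y + 2 * (b%:R / z) `^ d * ln b%:R).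
Proof.
pose w b := F b * (3 * ln y + 2 * (b%:R / z) `^ d * ln b%:R).
have w0 b : (0 < b)%N -> 0 <= w b.
  move=> b0; rewrite mulr_ge0 ?cosimple_weight_ge0 // addr_ge0 //.
    by rewrite mulr_ge0 // ltW.
  by rewrite !mulr_ge0 ?powR_ge0 // ln_ge0 // ler1n.
pose Fam b := [set S : {set 'I_Y.+1} |
    A (b * \prod_(p in S) (p : nat))%N && [forall p in S, (1 < p)%N]].
rewrite mulr_suml.
apply: (@le_trans _ _ (\sum_(1 <= b < N.+1) \sum_(S in Fam b)
    w b * \prod_(p in S) rankin_weight p)).
  apply: (@ler_sum_inj2 _ _ _ _ _ _ _ _ (fun b S => S \in Fam b)
    (cosimple_part K Y) (simple_primes K Y)); rewrite ?iota_uniq ?index_enum_uniq //.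
  - move=> a; rewrite !mem_index_iota => /andP[_ aN] /andP[Aa _].
    have a0 := A0 a Aa; have /andP[b0 ba] := cosimple_part_bounds K Y a a0.
    rewrite b0 (leq_ltn_trans ba aN) mem_index_enum inE -cosimple_partE // Aa.
    split=> //; apply/forall_inP => p /simple_primes_prime/andP[pp _].
    exact: prime_gt1.
  - move=> a a'; rewrite !inE => /andP[_ /andP[Aa _]] /andP[_ /andP[Aa' _]] e1 e2.
    by rewrite (cosimple_partE K Y a (A0 a Aa)) (cosimple_partE K Y a' (A0 a' Aa')) e1 e2.
  - move=> a; rewrite mem_index_iota => /andP[_ aN] /andP[Aa za].
    apply: weight_le_cosimple; first exact: A0.
    by rewrite za -le_N.
  - move=> b S; rewrite mem_index_iota => /andP[b0 _] _ _.
    rewrite mulr_ge0 ?w0 // prodr_ge0 // => p _.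
    by have /andP[] := rankin_weight_bounds p.
rewrite mulr_sumr big_nat [leRHS]big_nat; apply: ler_sum => b /andP[b0 _].
rewrite -mulr_sumr mulrC ler_wpM2r ?w0 //.
apply: weighted_sperner; last exact: rankin_weight_bounds.
exact: antichain_simple.
Qed.

Let c1_ge0 : 0 <= c1. Proof. by rewrite mulr_ge0 ?exprn_ge0. Qed.

Lemma sum_small_primes M :
  \sum_(0 <= p < M | prime p) (if (p <= K)%N then 2 ^+ k else 0) <= c1.
Proof.
rewrite -big_mkcondr /=.
have -> : c1 = \sum_(0 <= p < K.+1) 2 ^+ k by rewrite /c1 sumr_const_nat subn0 mulr_natl.
apply: (@ler_sum_inj _ _ _ _ _ _ _ id); rewrite ?iota_uniq //.
by move=> p _ /andP[_ pK]; rewrite mem_index_iota ltnS pK.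
Qed.

Lemma prime_weight p : prime p -> 0 <= f p <= 2 ^+ k.
Proof.
move=> pp; rewrite f0 ?prime_gt0 //=.
by have h := fB p 1 pp; rewrite expn1 in h.
Qed.

(** For p <= y one has p^d <= 1 + 2d ln p. The excess over L is at most 2 * 2^k * d times the sum of
    ln p / p, which is at most 32 ln y, and d ln y = ln 2 <= 1. *)
Lemma sum_rankin_weight_le : Lam <= L + 64 * 2 ^+ k.
Proof.
have -> : Lam = \sum_(0 <= p < Y.+1) rankin_weight p by rewrite big_mkord.
apply: (@le_trans _ _ (\sum_(0 <= p < Y.+1 | prime p)
   (f p / p%:R + 2 * 2 ^+ k * d * (ln p%:R / p%:R)))).
  rewrite [leRHS]big_mkcond [leLHS]big_nat [leRHS]big_nat; apply: ler_sum => p /andP[_ pY].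
  rewrite /rankin_weight; case: (boolP (prime p)) => //= pp.
  have /andP[fp0 fpk] := prime_weight p pp.
  have p0 : 0 < p%:R :> R by rewrite ltr0n prime_gt0.
  have lp0 : 0 <= ln p%:R :> R by rewrite ln_ge0 // ler1n prime_gt0.
  have e0 : 0 <= f p / p%:R + 2 * 2 ^+ k * d * (ln p%:R / p%:R).
    apply: addr_ge0; first by rewrite divr_ge0.
    apply: mulr_ge0; last by rewrite divr_ge0.
    by apply: mulr_ge0 (ltW d0); rewrite mulr_ge0 ?exprn_ge0.
  case: ifP => // _.
  set u := d * ln p%:R.
  have u0 : 0 <= u by rewrite mulr_ge0 // ltW.
  have pd : p%:R `^ d <= 1 + 2 * u.
    have e2 : p%:R `^ d <= 2.
      rewrite -yd; apply: ge0_ler_powR; rewrite ?nnegrE ?(ltW d0) ?(ltW y0) ?(ltW p0) //.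
      by rewrite -le_Y -ltnS.
    have := expR_ge1Dx (- u); rewrite expRN -powR_expR // => h.
    have q0 : 0 < p%:R `^ d by rewrite powR_gt0.
    have h1 : p%:R `^ d * (1 - u) <= 1.
      by rewrite mulrC -ler_pdivlMr // mul1r.
    move: (p%:R `^ d) q0 e2 h1 => q q0 e2 h1; move: u u0 h1 {h} => u u0 h1; nra.
  have -> : f p / p%:R + 2 * 2 ^+ k * d * (ln p%:R / p%:R) =
      (f p + 2 * 2 ^+ k * u) / p%:R by rewrite /u; ring.
  rewrite ler_wpM2r ?invr_ge0 ?(ltW p0) //.
  apply: (le_trans (ler_wpM2l fp0 pd)).
  have := ler_wpM2r u0 fpk; lra.
rewrite big_split /= lerD2l -mulr_sumr.
have H := sum_ln_primes_le R y y2.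
have k0 : 0 <= 2 ^+ k :> R by rewrite exprn_ge0.
apply: (le_trans (ler_wpM2l _ H)); first by apply: mulr_ge0 (ltW d0); rewrite mulr_ge0.
have -> : 2 * 2 ^+ k * d * (32 * ln y) = 64 * 2 ^+ k * ln 2.
  by rewrite /d; field; rewrite gt_eqF.
by rewrite ler_piMr ?mulr_ge0 // ln2_le1.
Qed.

Lemma sum_rankin_weight_ge : L <= Lam + c1.
Proof.
have -> : Lam = \sum_(0 <= p < Y.+1) rankin_weight p by rewrite big_mkord.
apply: (@le_trans _ _ (\sum_(0 <= p < Y.+1 | prime p)
   (rankin_weight p + (if (p <= K)%N then 2 ^+ k else 0)))).
  apply: ler_sum => p pp; have /andP[fp0 fpk] := prime_weight p pp.
  have p1 : 1 <= p%:R :> R by rewrite ler1n prime_gt0.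
  have p0 : 0 < p%:R :> R by lra.
  rewrite /rankin_weight pp /=; case: leqP => Kp; last first.
    rewrite addr0 ler_wpM2r ?invr_ge0 ?(ltW p0) // ler_peMr //.
    by apply: powR_ge1_nat; rewrite ?prime_gt0 // ltW.
  rewrite add0r ler_pdivrMr //; apply: (le_trans fpk).
  by rewrite ler_peMr // exprn_ge0.
rewrite big_split /=; apply: lerD; last exact: sum_small_primes.
rewrite big_mkcond le_eqVlt; apply/orP; left; apply/eqP/eq_bigr => p _.
by rewrite /rankin_weight; case: prime.
Qed.

(** The term -L cancels the factor e^L coming from the sets of simple primes. *)
Lemma sum_cosimple_weight_primes :
  \sum_(0 <= p < N.+1 | prime p) F p <=
  \sum_(0 <= p < N.+1 | prime p) f p / p%:R - L + c1.
Proof.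
rewrite addrAC lerBrDr.
have YN : (Y.+1 <= N.+1)%N by rewrite ltnS le_N (le_trans _ yz) // truncn_le ltW.
have -> : L = \sum_(0 <= p < N.+1 | prime p) (if (p <= Y)%N then f p / p%:R else 0).
  by rewrite /L (big_nat_widen _ _ N.+1) // big_mkcondr.
rewrite -big_split /=.
apply: (@le_trans _ _ (\sum_(0 <= p < N.+1 | prime p)
   (f p / p%:R + (if (p <= K)%N then 2 ^+ k else 0)))).
  by apply: ler_sum => p pp; exact: cosimple_weight_prime.
by rewrite big_split /= lerD2l sum_small_primes.
Qed.

Lemma sum_primitive_bound (G C M : R) :
    0 <= G ->
    \sum_(1 <= b < N.+1) F b * (b%:R / z) `^ d * ln b%:R <=
      G / d * \sum_(1 <= b < N.+1) F b ->
    \sum_(1 <= b < N.+1) F b <= expR C * expR (\sum_(0 <= p < N.+1 | prime p) F p) ->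
    expR (\sum_(0 <= p < N.+1 | prime p) p%:R^-1) <= M * ln z ->
  \sum_(0 <= a < N.+1 | A a && (z / y <= a%:R)) f a / a%:R <=
  (3 * expR (64 * 2 ^+ k) * (1 + c1) * ((3 + 4 * G) * (expR C * expR c1)) * M) *
  (ln y / Num.sqrt (L + 1)) *
  expR (\sum_(0 <= p < N.+1 | prime p) (f p - 1) / p%:R).
Proof.
move=> G0 HG HC HM.
set P := \sum_(0 <= p < N.+1 | prime p) f p / p%:R.
set Q := \sum_(0 <= p < N.+1 | prime p) p%:R^-1 in HM.
have -> : \sum_(0 <= p < N.+1 | prime p) (f p - 1) / p%:R = P - Q.
  by rewrite /P /Q -sumrB; apply: eq_bigr => p _; rewrite mulrBl mul1r.
set E := \sum_(1 <= b < N.+1) F b in HG HC.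
have E0 : 0 <= E by apply: sumr_ge0 => b _; exact: cosimple_weight_ge0.
have lnz0 : 0 < ln z.
  by apply: lt_le_trans lny0 _; rewrite ler_ln ?posrE.
have L0 : 0 <= L.
  by apply: sumr_ge0 => p pp; have /andP[h _] := prime_weight p pp; rewrite divr_ge0.
have Lam0 : 0 <= Lam.
  by apply: sumr_ge0 => p _; have /andP[] := rankin_weight_bounds p.
have hE : E <= expR C * expR c1 * expR (P - L).
  apply: (le_trans HC); rewrite -mulrA ler_wpM2l ?expR_ge0 // -expRD ler_expR.
  by rewrite addrC; exact: sum_cosimple_weight_primes.
(* The constant 3 + 4G combines the term 3 ln y with 2G/d <= 4G ln y. *)
have hw : \sum_(1 <= b < N.+1) F b * (3 * ln y + 2 * (b%:R / z) `^ d * ln b%:R) <=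
    (3 + 4 * G) * ln y * E.
  have -> : \sum_(1 <= b < N.+1) F b * (3 * ln y + 2 * (b%:R / z) `^ d * ln b%:R) =
      3 * ln y * E + 2 * \sum_(1 <= b < N.+1) F b * (b%:R / z) `^ d * ln b%:R.
    rewrite /E !mulr_sumr -big_split /=; apply: eq_bigr => b _.
    by move: ((b%:R / z) `^ d) => u; ring.
  have : G / d * E <= 2 * G * ln y * E.
    rewrite ler_wpM2r //; have := ler_wpM2l G0 dV; lra.
  move: HG; set S := \sum_(1 <= b < N.+1) _; nra.
have sL : 0 < Num.sqrt (L + 1) by rewrite sqrtr_gt0; lra.
have sLam : 0 < Num.sqrt (Lam + 1) by rewrite sqrtr_gt0; lra.
(* Indeed L + 1 <= Lam + 1 + c1 <= (1 + c1)^2 (Lam + 1). *)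
have hsqrt : (Num.sqrt (Lam + 1))^-1 <= (1 + c1) / Num.sqrt (L + 1).
  rewrite ler_pdivlMr // mulrC ler_pdivrMr //.
  have c10 : 0 <= 1 + c1 by have := c1_ge0; lra.
  rewrite -[1 + c1]ger0_norm // -sqrtr_sqr -sqrtrM ?sqr_ge0 //.
  apply: ler_wsqrtr; have := sum_rankin_weight_ge; have := c1_ge0; nra.
have hB : 3 * expR Lam / Num.sqrt (Lam + 1) <=
    3 * (expR (64 * 2 ^+ k) * expR L) * ((1 + c1) / Num.sqrt (L + 1)).
  apply: ler_pM => //; rewrite ?mulr_ge0 ?expR_ge0 ?invr_ge0 ?sqrtr_ge0 //.
  by rewrite ler_pM2l // -expRD ler_expR addrC sum_rankin_weight_le.
rewrite -(ler_pM2r lnz0); apply: (le_trans sum_primitive_le).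
apply: (@le_trans _ _ (3 * (expR (64 * 2 ^+ k) * expR L) * ((1 + c1) / Num.sqrt (L + 1)) *
    ((3 + 4 * G) * ln y * (expR C * expR c1 * expR (P - L))))).
  apply: ler_pM => //.
  - rewrite big_nat; apply: sumr_ge0 => b /andP[b0 _].
    rewrite mulr_ge0 ?cosimple_weight_ge0 // addr_ge0 //; first by rewrite mulr_ge0 // ltW.
    by rewrite !mulr_ge0 ?powR_ge0 // ln_ge0 // ler1n.
  - apply: (le_trans hw); rewrite ler_wpM2l // mulr_ge0 ?(ltW lny0) //; lra.
(* The exponentials recombine into e^P = e^(P-Q) e^Q, and Mertens' bound e^Q <= M ln z pays for the
   factor ln z by which both sides were multiplied. *)
have eP : expR L * expR (P - L) = expR P by rewrite -expRD addrC subrK.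
have eQ : expR (P - Q) * expR Q = expR P by rewrite -expRD subrK.
set T := 3 * expR (64 * 2 ^+ k) * (1 + c1) * ((3 + 4 * G) * (expR C * expR c1)).
set V := ln y / Num.sqrt (L + 1).
have -> : 3 * (expR (64 * 2 ^+ k) * expR L) * ((1 + c1) / Num.sqrt (L + 1)) *
    ((3 + 4 * G) * ln y * (expR C * expR c1 * expR (P - L))) =
    T * V * (expR L * expR (P - L)) by rewrite /T /V; ring.
rewrite eP -eQ.
have -> : T * M * V * expR (P - Q) * ln z = T * V * (expR (P - Q) * (M * ln z)) by ring.
have T0 : 0 <= T.
  have := c1_ge0 => c10; rewrite /T !mulr_ge0 ?expR_ge0 //; lra.
have V0 : 0 <= V by rewrite divr_ge0 ?ltW.
apply: ler_wpM2l; first exact: mulr_ge0.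
by apply: ler_wpM2l; first exact: expR_ge0.
Qed.

End PrimitiveSums.

(** * Choice of the constant and the final estimate *)

Lemma primitive_sum_bound (R : realType) (k : nat) : exists C : R,
  forall (z y : R) (A : pred nat) (f : nat -> R),
    2 <= y -> y <= z ->
    (forall a, A a -> (0 < a)%N) ->
    (forall a b, A a -> A b -> a <> b -> ~~ (a %| b)%N) ->
    f 1%N = 1 ->
    (forall m n, (0 < m)%N -> (0 < n)%N -> coprime m n -> f (m * n)%N = f m * f n) ->
    (forall n, (0 < n)%N -> 0 <= f n) ->
    (forall p v, prime p -> f (p ^ v)%N <= v.+1%:R ^+ k) ->
    let L := \sum_(0 <= p < (Num.truncn y).+1 | prime p) f p / p%:R in
  \sum_(0 <= a < (Num.truncn z).+1 | A a && (z / y <= a%:R)) f a / a%:R <=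
  C * (ln y / Num.sqrt (L + 1)) *
  expR (\sum_(0 <= p < (Num.truncn z).+1 | prime p) (f p - 1) / p%:R).
Proof.
have [G G0 HG] := sum_prime_powers_weighted R k.
have [C HC] := sum_le_expR_primes R k.
have [M M0 HM] := mertens_upper R.
(* [G], [C] and [M] were obtained before [z], [y], [A] and [f] are introduced, so the constant
   depends on [k] alone. *)
eexists => z y A f y2 yz A0 Aprim f1 fM f0 fB /=.
apply: (sum_primitive_bound R k z y A f y2 yz A0 Aprim f1 fM f0 fB G C M (ltW G0)).
- have l2 := ln2_ge_half R.
  have l2y : ln 2 <= ln y by rewrite ler_ln ?posrE //; lra.
  have ly0 : 0 < ln y by lra.
  have d0 : 0 < ln 2 / ln y by rewrite divr_gt0 //; lra.
  have d1 : ln 2 / ln y <= 1 by rewrite ler_pdivrMr // mul1r.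
  apply: sum_ln_weighted => //; [lra | exact: ltW | | | ].
  + exact: cosimple_weight_ge0.
  + exact: cosimple_weightM.
  + move=> Z Z1; apply: HG => //; first by rewrite d0.
      exact: cosimple_weight_ge0.
    exact: cosimple_weight_pp.
- apply: HC; [exact: cosimple_weight_ge0 | exact: cosimple_weight1 |
    exact: cosimple_weightM | exact: cosimple_weight_pp].
- by apply: HM; lra.
Qed.

(* [GRing.Theory] shadows [multiplicative]. *)
Import Defs.

Theorem theorem4p1 (k : nat) : (1 <= k)%N ->
  exists C : Rdefinitions.R,
  forall (z y : Rdefinitions.R) (A : pred nat) (f : nat -> Rdefinitions.R),
    2 <= y -> y <= z ->
    primitive A ->
    multiplicative f ->
    (forall n, (0 < n)%N -> 0 <= f n /\ f n <= (tau k n)%:R) ->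
    let L := \sum_(0 <= p < (Num.truncn y).+1 | prime p && (p%:R <= y))
               f p / p%:R in
    \sum_(0 <= a < (Num.truncn z).+1 | A a && (z / y <= a%:R) && (a%:R <= z))
        f a / a%:R
    <= C * (ln y / Num.sqrt (L + 1)) *
       expR (\sum_(0 <= p < (Num.truncn z).+1 | prime p && (p%:R <= z))
               (f p - 1) / p%:R).
Proof.
move=> _; have [C HC] := primitive_sum_bound Rdefinitions.R k.
exists C => z y A f y2 yz [A0 Aprim] [f1 fM] fB /=.
have y0 : 0 <= y by apply: le_trans y2.
have z0 : 0 <= z by apply: le_trans yz.
have f0 n : (0 < n)%N -> 0 <= f n by case/fB.
have fpp p v : prime p -> f (p ^ v)%N <= v.+1%:R ^+ k.
  move=> pp; have [] := fB (p ^ v)%N; first by rewrite expn_gt0 prime_gt0.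
  by move=> _ /le_trans; apply; rewrite -natrX ler_nat tau_prime_power.
(* For x >= 0 the range up to [Num.truncn x] already means n <= x. *)
have drop_le (x : Rdefinitions.R) (P : pred nat) (g : nat -> Rdefinitions.R) : 0 <= x ->
    \sum_(0 <= n < (Num.truncn x).+1 | P n && (n%:R <= x)) g n =
    \sum_(0 <= n < (Num.truncn x).+1 | P n) g n.
  move=> x0; rewrite big_nat_cond [RHS]big_nat_cond; apply: eq_bigl => n.
  by rewrite ltnS truncn_ge_nat //=; case: (n%:R <= x); rewrite ?andbT ?andbF.
rewrite !drop_le //; exact: HC.
Qed.
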